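(* Let $(M,\alpha,\omega,g)$ be an Einstein almost cokähler manifold of dimension $2n+1$ with $\mathrm{Ric}=\tau g$ ($\tau$ constant). Then, at every point of $M$, $$0\leq-\tau\leq 2n(\tau^*-\tau).$$
   Context: An almost contact metric structure $(\alpha,\omega,g)$ on a $(2n+1)$-dimensional manifold $M$ consists of a $1$-form $\alpha$, a $2$-form $\omega$ and a Riemannian metric $g$ such that near each point there is an orthonormal coframe $e^1,\dots,e^{2n+1}$ with $\alpha=e^{2n+1}$ and $\omega=e^{1}\wedge e^2+e^3\wedge e^4+\dots+e^{2n-1}\wedge e^{2n}$. It is almost cokähler if $d\alpha=0$ and $d\omega=0$. It is Einstein if $\mathrm{Ric}=\tau g$ with $\tau$ constant. Let $J$ be the endomorphism of $TM$ with $\omega(X,Y)=g(JX,Y)$ (so $J$ kills the Reeb vector field $\xi=e_{2n+1}$ and is an almost complex structure on $\ker\alpha$). With $\nabla$ the Levi-Civita connection, $R(X,Y)Z=\nabla_X\nabla_YZ-\nabla_Y\nabla_XZ-\nabla_{[X,Y]}Z$ and a local orthonormal frame $e_1,\dots,e_{2n+1}$, the $*$-Ricci form is $\rho^*(X,Y)=\sum_i g(R(X,e_i)(Je_i),Y)$, and $\tau^*$ is the function $\tau^*=\frac1n\langle\omega,\rho^*\rangle$, where the inner product on $2$-forms is the one for which the $e^i\wedge e^j$, $i<j$, are orthonormal. The manifold is not assumed to be compact. *)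

(* Defs.v *)
From HB Require Import structures.
From mathcomp Require Import all_boot all_order all_algebra.
From mathcomp Require Import ring lra.
From mathcomp Require Import all_classical all_reals all_analysis.

Set Implicit Arguments.
Unset Strict Implicit.
Unset Printing Implicit Defensive.

Import Order.TTheory GRing.Theory Num.Theory.
Import numFieldNormedType.Exports.

Local Open Scope classical_set_scope.
Local Open Scope ring_scope.

(* Tangent vectors and 1-forms at a point are row vectors of components in a
   chart; the value of a 1-form t at v is t v^T; a matrix B stands for the bilinear
   form (u, v) |-> u B v^T, and an endomorphism A acts by u |-> u A. *)

Section Calculus.
Variables (R : realType) (m : nat).
Implicit Types (U : set 'rV[R]_m) (f : 'rV[R]_m -> R) (x : 'rV[R]_m).

Definition partial (i : 'I_m) f : 'rV[R]_m -> R :=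
  fun x => 'D_(delta_mx 0 i) f x.

(* Only meant for U open. *)
Fixpoint Ck (k : nat) U f : Prop :=
  if k is k'.+1 then
    (forall i x, U x -> derivable f x (delta_mx 0 i)) /\
    (forall i, Ck k' U (partial i f))
  else {in U, continuous f}.

Definition smooth_on U f : Prop := forall k, Ck k U f.

End Calculus.

Section Manifold.
Variables (R : realType) (m : nat).

(* The maps chart and chart_inv are total; their values matter only on
   chart_dom and on its image. *)
Record manifold : Type := Manifold {
  carrier :> topologicalType;
  carrier_hausdorff : hausdorff_space carrier;
  carrier_second_countable : @second_countable carrier;
  chart_index : Type;
  chart_dom : chart_index -> set carrier;
  chart : chart_index -> carrier -> 'rV[R]_m;
  chart_inv : chart_index -> 'rV[R]_m -> carrier;
  chart_cover : forall p, exists a, chart_dom a p;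
  chart_dom_open : forall a, open (chart_dom a);
  chart_img_open : forall a, open (chart a @` chart_dom a);
  chart_continuous : forall a, {in chart_dom a, continuous (chart a)};
  chart_inv_continuous : forall a,
    {in chart a @` chart_dom a, continuous (chart_inv a)};
  chartK : forall a p, chart_dom a p -> chart_inv a (chart a p) = p;
  chart_transition_smooth : forall a b (j : 'I_m),
    smooth_on (chart a @` (chart_dom a `&` chart_dom b))
      (fun x => chart b (chart_inv a x) 0 j)
}.

Variable M : manifold.

Definition transition (a b : chart_index M) : 'rV[R]_m -> 'rV[R]_m :=
  fun x => chart b (chart_inv a x).

(* Components in each chart, as functions of the coordinates of that chart. *)
Definition covector_field := chart_index M -> 'rV[R]_m -> 'rV[R]_m.
Definition bilinear_field := chart_index M -> 'rV[R]_m -> 'M[R]_m.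

Definition is_one_form (W : set M) (th : covector_field) : Prop :=
  (forall a k, smooth_on (chart a @` (chart_dom a `&` W))
                 (fun x => th a x 0 k)) /\
  (forall a b p, W p -> chart_dom a p -> chart_dom b p ->
     th a (chart a p) =
     th b (chart b p) *m (jacobian (transition a b) (chart a p))^T).

Definition is_bilinear_field (W : set M) (B : bilinear_field) : Prop :=
  (forall a k l, smooth_on (chart a @` (chart_dom a `&` W))
                   (fun x => B a x k l)) /\
  (forall a b p, W p -> chart_dom a p -> chart_dom b p ->
     let D := jacobian (transition a b) (chart a p) in
     B a (chart a p) = D *m B b (chart b p) *m D^T).

Definition is_two_form (om : bilinear_field) : Prop :=
  is_bilinear_field setT om /\
  forall a p, chart_dom a p -> (om a (chart a p))^T = - om a (chart a p).

Definition is_riemannian_metric (g : bilinear_field) : Prop :=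
  is_bilinear_field setT g /\
  forall a p, chart_dom a p ->
    (g a (chart a p))^T = g a (chart a p) /\
    forall u : 'rV[R]_m, u != 0 -> 0 < (u *m g a (chart a p) *m u^T) 0 0.

Definition closed_one_form (al : covector_field) : Prop :=
  forall a p (i j : 'I_m), chart_dom a p ->
    partial i (fun x => al a x 0 j) (chart a p)
    - partial j (fun x => al a x 0 i) (chart a p) = 0.

Definition closed_two_form (om : bilinear_field) : Prop :=
  forall a p (i j k : 'I_m), chart_dom a p ->
    partial i (fun x => om a x j k) (chart a p)
    + partial j (fun x => om a x k i) (chart a p)
    + partial k (fun x => om a x i j) (chart a p) = 0.

End Manifold.

Section LocalGeometry.
Variables (R : realType) (m : nat).
Local Notation vector_field := ('rV[R]_m -> 'rV[R]_m).
Implicit Types (B : 'M[R]_m) (G Om : 'rV[R]_m -> 'M[R]_m).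
Implicit Types (x u v w : 'rV[R]_m) (X Y Z : vector_field).

Definition bil B u v : R := (u *m B *m v^T) 0 0.

(* Gamma^k_ij of the Levi-Civita connection of G. *)
Definition christoffel G (k i j : 'I_m) x : R :=
  2^-1 * \sum_l invmx (G x) k l *
    (partial i (fun y => G y j l) x + partial j (fun y => G y i l) x
     - partial l (fun y => G y i j) x).

Definition nabla G X Y : vector_field := fun x =>
  \row_k ('D_(X x) (fun y => Y y 0 k) x
          + \sum_i \sum_j X x 0 i * Y x 0 j * christoffel G k i j x).

Definition lie_bracket X Y : vector_field := fun x =>
  \row_k ('D_(X x) (fun y => Y y 0 k) x - 'D_(Y x) (fun y => X y 0 k) x).

Definition curvature G X Y Z : vector_field := fun x =>
  nabla G X (nabla G Y Z) x - nabla G Y (nabla G X Z) x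
  - nabla G (lie_bracket X Y) Z x.

(* By tensoriality the value at x depends only on the three vectors at x; they
   are extended by constant components in the chart. *)
Definition riem G x u v w : 'rV[R]_m :=
  curvature G (fun=> u) (fun=> v) (fun=> w) x.

(* Trace of the endomorphism w |-> R(w, u)v. *)
Definition ricci G x u v : R := \sum_k riem G x (delta_mx 0 k) u v 0 k.

(* The J with om(u, v) = g(Ju, v): see Jend_spec below. *)
Definition Jend G Om x u : 'rV[R]_m := u *m (Om x *m invmx (G x)).

Definition orthonormal_basis B (e : 'I_m -> 'rV[R]_m) : Prop :=
  forall i j, bil B (e i) (e j) = (i == j)%:R.

Definition star_ricci G Om x (e : 'I_m -> 'rV[R]_m) u v : R :=
  \sum_i bil (G x) (riem G x u (e i) (Jend G Om x (e i))) v.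

(* The inner product of 2-forms for which the e^i /\ e^j, i < j, are
   orthonormal, e^i being the coframe dual to the orthonormal basis e. *)
Definition two_form_inner (e : 'I_m -> 'rV[R]_m)
    (s t : 'rV[R]_m -> 'rV[R]_m -> R) : R :=
  \sum_(i < m) \sum_(j < m | (i < j)%N) s (e i) (e j) * t (e i) (e j).

Definition star_tau (n : nat) G Om x (e : 'I_m -> 'rV[R]_m) : R :=
  n%:R^-1 * two_form_inner e (bil (Om x)) (star_ricci G Om x e).

Lemma Jend_spec G Om x u v : G x \in unitmx ->
  bil (Om x) u v = bil (G x) (Jend G Om x u) v.
Proof. by move=> Gx; rewrite /bil /Jend -!mulmxA mulKmx. Qed.

Lemma partial_metric_sym G x (k i j : 'I_m) :
  (\forall y \near x, (G y)^T = G y) ->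
  partial k (fun y => G y i j) x = partial k (fun y => G y j i) x.
Proof.
move=> sG; apply: near_eq_derive.
by apply: filterS sG => y /matrixP/(_ i j); rewrite mxE.
Qed.

(* christoffel_sym and christoffel_metric say that nabla is torsion-free and
   metric. *)
Lemma christoffel_sym G x (k i j : 'I_m) :
  (\forall y \near x, (G y)^T = G y) ->
  christoffel G k i j x = christoffel G k j i x.
Proof.
move=> sG; congr (_ * _); apply: eq_bigr => l _.
by rewrite (partial_metric_sym l i j sG) [partial i _ x + _]addrC.
Qed.

Lemma christoffel_lower G x (i j l : 'I_m) :
  (G x)^T = G x -> G x \in unitmx ->
  \sum_k christoffel G k i j x * G x k l =
  2^-1 * (partial i (fun y => G y j l) x + partial j (fun y => G y i l) x
          - partial l (fun y => G y i j) x).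
Proof.
move=> sG uG; set T := fun l => partial i (fun y => G y j l) x
  + partial j (fun y => G y i l) x - partial l (fun y => G y i j) x.
under eq_bigr do rewrite -mulrA; rewrite -mulr_sumr; congr (_ * _).
transitivity (\sum_r T r * (G x *m invmx (G x)) l r); last first.
  rewrite mulmxV// (bigD1 l)//= big1 ?addr0 ?mxE ?eqxx ?mulr1// => r rl.
  by rewrite mxE eq_sym (negbTE rl) mulr0.
under eq_bigr do rewrite mulr_suml.
rewrite exchange_big/=; apply: eq_bigr => r _.
rewrite mxE mulr_sumr; apply: eq_bigr => k _.
have -> : G x l k = G x k l by rewrite -{1}sG mxE.
by rewrite -/(T r); ring.
Qed.

Lemma christoffel_metric G x (k i j : 'I_m) :
  (\forall y \near x, (G y)^T = G y) -> G x \in unitmx ->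
  partial k (fun y => G y i j) x =
  \sum_l christoffel G l k i x * G x l j
  + \sum_l christoffel G l k j x * G x i l.
Proof.
move=> nG uG; have sG : (G x)^T = G x := nbhs_singleton nG.
rewrite christoffel_lower//.
under [X in _ = _ + X]eq_bigr do rewrite -[in G x i _]sG mxE.
rewrite christoffel_lower//.
by rewrite (partial_metric_sym k j i nG); lra.
Qed.

End LocalGeometry.

Section AlmostContact.
Variables (R : realType) (m : nat).

(* (a /\ b)(u, v) = a(u) b(v) - a(v) b(u). *)
Definition wedge (a b : 'rV[R]_m) : 'M[R]_m := a^T *m b - b^T *m a.

(* Orthonormality is for the inner product on covectors dual to B. *)
Definition orthonormal_coframe (B : 'M[R]_m) (th : 'I_m -> 'rV[R]_m) : Prop :=
  forall i j, bil (invmx B) (th i) (th j) = (i == j)%:R.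

End AlmostContact.

Section Structures.
Variables (R : realType) (n : nat) (M : manifold R n.*2.+1).
Implicit Types (alpha : covector_field M) (omega g : bilinear_field M).

(* With indices from 0: alpha = e^(2n) and omega is the sum over k < n of
   e^(2k) /\ e^(2k+1). *)
Definition almost_contact_metric alpha omega g : Prop :=
  [/\ is_one_form setT alpha, is_two_form omega, is_riemannian_metric g &
   forall p : M, exists (W : set M) (th : 'I_n.*2.+1 -> covector_field M),
     [/\ open W, W p, forall i, is_one_form W (th i) &
      forall a q, W q -> chart_dom a q ->
        let x := chart a q in
        [/\ orthonormal_coframe (g a x) (fun i => th i a x),
            alpha a x = th ord_max a x &
            omega a x = \sum_(k < n)
              wedge (th (inord k.*2) a x) (th (inord k.*2.+1) a x)]]].

Definition almost_cokahler alpha omega g : Prop :=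
  [/\ almost_contact_metric alpha omega g,
      closed_one_form alpha & closed_two_form omega].

Definition einstein g (tau : R) : Prop :=
  forall a p, chart_dom a p -> forall u v : 'rV[R]_n.*2.+1,
    ricci (g a) (chart a p) u v = tau * bil (g a (chart a p)) u v.

End Structures.

(* Main.v *)
Require Import Defs.
From HB Require Import structures.
From mathcomp Require Import all_boot all_order all_algebra.
From mathcomp Require Import ring lra.
From mathcomp Require Import all_classical all_reals all_analysis.

Set Implicit Arguments.
Unset Strict Implicit.
Unset Printing Implicit Defensive.

Import Order.TTheory GRing.Theory Num.Theory.
Import numFieldNormedType.Exports.

Local Open Scope classical_set_scope.
Local Open Scope ring_scope.

(* Both inequalities come from a commuted-derivative identity: if div F = 0 and
   the contraction K^b (nabla_b F)^a vanishes, then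
     K^b ([nabla_a, nabla_b] F)^a = - nabla_a K^b nabla_b F^a.
   For K = F = xi the left side is Ric(xi, xi) = tau and the right side is
   - |nabla alpha|^2, because nabla alpha is symmetric.  For F = J and K = J with
   its index raised, the left side is 2n(tau* - tau), and d omega = 0 turns the
   right side into |nabla omega|^2 (norm of forms).  The hypotheses hold because
   d alpha = 0, d omega = 0 and the constant length of alpha and omega force
   xi and J to be divergence free and xi to be geodesic.  Finally
   nabla omega(xi, .) = - omega(nabla xi, .) is as long as nabla alpha, and for
   an antisymmetric T and a unit vector a one has |a T|^2 <= |T|^2 / 2. *)

(** * Directional derivatives *)

(** [Ck] only speaks of iterated partial derivatives, while [nabla] differentiates along arbitrary
    vectors. Additivity of directional derivatives and symmetry of second derivatives are therefore
    derived from the mean value theorem. All differentiation takes place in chart components, with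
    Christoffel symbols. An orthonormal frame is only a matrix [P] at one point, with
    [P *m G *m P^T = 1%:M], and is never differentiated: nabla alpha and nabla omega are tensors, so
    a change of basis at that point suffices. The value 2n(tau* - tau) arises as follows. With K = H
    Om H and J = Om H, where H is the inverse metric, K J = xi^T xi - H. The half of the commutator
    in which J comes next to K thus contracts to Ric(xi, xi) minus the scalar curvature, tau -
    (2n+1) tau = -2n tau. The other half is twice the inner product of omega and rho*, which is 2n
    tau*. The constants match without loss: d omega = 0 produces half of the sum of the squares
    (nabla_i omega_jk)^2, and the bound on |a T|^2 has the same factor 1/2. *)

Lemma not_halfway (R : realFieldType) (a b c : R) :
  `|a - c| < `|a - b| / 2 -> `|b - c| < `|a - b| / 2 -> False.
Proof.
have := ler_distD c a b; rewrite [`|c - b|]distrC; lra.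
Qed.

Section DirectionalDerivatives.
Variables (R : realType) (V : normedModType R).
Implicit Types (f : V -> R) (x u v : V) (h t : R).

Lemma is_derive_line f x v t : derivable f (t *: v + x) v ->
  is_derive t 1 (fun s => f (s *: v + x)) ('D_v f (t *: v + x)).
Proof.
have E : (fun h => h^-1 *: (((fun s => f (s *: v + x)) \o shift t) (h *: 1)
            - f (t *: v + x))) =
         (fun h => h^-1 *: ((f \o shift (t *: v + x)) (h *: v) - f (t *: v + x))).
  by apply/funext => h /=; rewrite [h *: 1]mulr1 scalerDl addrA.
by move=> df; apply: DeriveDef; rewrite /derivable /derive E.
Qed.

(** The sign of [h] is left free because derivatives are limits along [0^']; hence the intermediate
    point is located by [|t| <= |h|] and not by an interval. *)
Lemma MVT_line f x v h :
  (forall t, `|t| <= `|h| -> derivable f (t *: v + x) v) ->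
  exists2 t, `|t| <= `|h| & f (h *: v + x) - f x = h * 'D_v f (t *: v + x).
Proof.
move=> df; pose phi s := f (s *: v + x).
have dphi t : `|t| <= `|h| -> is_derive t 1 phi ('D_v f (t *: v + x)).
  by move=> th; exact/is_derive_line/df.
have cphi (c d : R) : (forall t, t \in `[c, d] -> `|t| <= `|h|) ->
    {within `[c, d], continuous phi}.
  move=> cd; apply: derivable_within_continuous => t tcd.
  exact: (@ex_derive _ _ _ _ _ _ _ (dphi _ (cd _ tcd))).
have phi0 : phi 0 = f x by rewrite /phi scale0r add0r.
have [h0|h0] := leP 0 h.
  have hh t : t \in `[0, h] -> `|t| <= `|h|.
    by rewrite in_itv /= => /andP[t0 th]; rewrite !ger0_norm.
  have [|t tI E] := MVT_segment (df := fun t => 'D_v f (t *: v + x)) h0 _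
    (cphi _ _ hh).
    by move=> t tI; apply/dphi/hh/subset_itv_oo_cc.
  by exists t; [exact: hh|rewrite -phi0 E subr0 mulrC].
have hh t : t \in `[h, 0] -> `|t| <= `|h|.
  rewrite in_itv /= => /andP[th t0].
  by rewrite !ler0_norm ?lerN2// ltW.
have [|t tI E] := MVT_segment (df := fun t => 'D_v f (t *: v + x)) (ltW h0) _
  (cphi _ _ hh).
  by move=> t tI; apply/dphi/hh/subset_itv_oo_cc.
exists t; first exact: hh.
by rewrite -phi0 -[LHS]opprB [f _]/(phi h) E sub0r mulrN opprK mulrC.
Qed.

(** The quotient along [u + v] is the quotient along [u] at [x] plus [q], a quotient along [v] at
    the moving point [h *: u + x]. The mean value theorem makes [q] a value of ['D_v f] near [x],
    and continuity gives its limit. *)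
Lemma is_derive_dirD f x u v :
  derivable f x u -> (\forall y \near x, derivable f y v) ->
  {for x, continuous ('D_v f)} ->
  is_derive x (u + v) f ('D_u f x + 'D_v f x).
Proof.
move=> du dv cv; pose q h := h^-1 *: (f (h *: (u + v) + x) - f (h *: u + x)).
have qv : q h @[h --> 0^'] --> 'D_v f x.
  apply/cvgrPdist_lt => e e0.
  have /nbhs_ballP[d /= d0 dP] : \forall y \near x,
      derivable f y v /\ `|'D_v f x - 'D_v f y| < e.
    by near=> y; split; near: y; [exact: dv|move/cvgrPdist_lt: cv; exact].
  (* For [|h| < c] all points [t *: v + (h *: u + x)] with [|t| <= |h|] stay in the ball of radius
     [d]; the 1 keeps the denominator positive. *)
  pose c := d / (`|u| + `|v| + 1).
  have c0 : 0 < c by rewrite divr_gt0// ltr_wpDl.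
  near=> h.
  have hc : `|h| < c by near: h; apply: dnbhs0_lt.
  have hN0 : h != 0 by near: h; exact: nbhs_dnbhs_neq.
  have yd t : `|t| <= `|h| -> ball x d (t *: v + (h *: u + x)).
    move=> th; rewrite -ball_normE /ball_ /= addrA opprD addrCA subrr addr0 normrN.
    rewrite (le_lt_trans (ler_normD _ _))// !normrZ.
    rewrite (@le_lt_trans _ _ (`|h| * (`|u| + `|v| + 1)))//; last first.
      by rewrite -ltr_pdivlMr// ltr_wpDl.
    rewrite !mulrDr mulr1 -[leLHS]addr0 lerD ?normr_ge0//.
    by rewrite addrC lerD// ler_wpM2r.
  have [t th E] := MVT_line (fun t th => (dP _ (yd t th)).1).
  rewrite /q [h *: (u + v)]scalerDr [h *: u + h *: v]addrC -addrA E [_ *: _]mulKf//.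
  exact: (dP _ (yd t th)).2.
have E : (fun h => h^-1 *: ((f \o shift x) (h *: (u + v)) - f x)) =
    (fun h => h^-1 *: ((f \o shift x) (h *: u) - f x)) \+ q.
  by apply/funext => h /=; rewrite /q -scalerDr [X in _ = _ *: X]addrC subrKA.
have : h^-1 *: ((f \o shift x) (h *: (u + v)) - f x) @[h --> 0^']
    --> 'D_u f x + 'D_v f x.
  by rewrite E; exact: (cvgD du qv).
move=> H; apply: DeriveDef; first by apply/cvg_ex; exists ('D_u f x + 'D_v f x).
exact/cvg_lim.
Unshelve. all: by end_near. Qed.

Lemma is_derive_dirZ f x v (c : R) : derivable f x v ->
  is_derive x (c *: v) f (c * 'D_v f x).
Proof.
move=> df; pose phi s := f (s *: v + x).
have dphi : is_derive (c *: 0 : R) 1 phi ('D_v f x).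
  have := @is_derive_line f x v 0.
  by rewrite scaler0 scale0r add0r; apply.
have dc : is_derive (0 : R) 1 ( *:%R c : R -> R) c.
  by apply: is_derive_eq; rewrite [LHS]mulr1.
have := is_derive1_comp dphi dc.
have E : (fun h => h^-1 *: (((phi \o *:%R c) \o shift 0) (h *: 1)
            - (phi \o *:%R c) 0)) =
         (fun h => h^-1 *: ((f \o shift x) (h *: (c *: v)) - f x)).
  apply/funext => h /=; rewrite /phi addr0 scaler0 scale0r add0r.
  by rewrite [h *: 1]mulr1 scalerA mulrC.
case; rewrite /derivable /derive E mulrC => d1 d2.
exact: DeriveDef.
Qed.

(** Two mean value steps: along [u] for [F y = f (h *: v + y) - f y], then along [v] for ['D_u f].
    The left side is symmetric in [u] and [v], the right side is not, which is what [derive_comm]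
    exploits. *)
Lemma second_difference f x u v (A : set V) : nbhs x A ->
  (forall y, A y -> derivable f y u) ->
  (forall y, A y -> derivable ('D_u f) y v) ->
  \forall h \near 0^'+, exists2 y, A y &
    f (h *: u + (h *: v + x)) - f (h *: u + x) - f (h *: v + x) + f x
    = h ^+ 2 * 'D_v ('D_u f) y.
Proof.
move=> /nbhs_ballP[d /= d0 dA] du duv.
pose c := d / (`|u| + `|v| + 1).
have c0 : 0 < c by rewrite divr_gt0// ltr_wpDl.
near=> h.
have h0 : 0 < h by near: h; exact: nbhs_right_gt.
have hc : h < c by near: h; exact: nbhs_right_lt.
have yd s t : `|s| <= `|h| -> `|t| <= `|h| -> A (s *: u + (t *: v + x)).
  move=> sh th; apply: dA.
  rewrite -ball_normE /ball_ /= addrA opprD addrCA subrr addr0 normrN.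
  rewrite (le_lt_trans (ler_normD _ _))// !normrZ.
  rewrite (@le_lt_trans _ _ (h * (`|u| + `|v| + 1)))//; last first.
    by rewrite -ltr_pdivlMr// ltr_wpDl.
  rewrite (gtr0_norm h0) in sh th.
  by rewrite !mulrDr mulr1 -[leLHS]addr0 !lerD ?ler_wpM2r// ltW.
pose F y := f (h *: v + y) - f y.
have dF t : `|t| <= `|h| -> is_derive (t *: u + x) u F
    ('D_u f (h *: v + (t *: u + x)) - 'D_u f (t *: u + x)).
  move=> th.
  have A1 : A (h *: v + (t *: u + x)) by rewrite addrCA; apply: yd.
  have A2 : A (t *: u + x).
    by have := yd t 0 th; rewrite scale0r add0r normr0; apply.
  apply: is_deriveB; last exact/derivableP/du.
  have E : (fun h0 => h0^-1 *: (((fun y => f (h *: v + y)) \o shift (t *: u + x))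
        (h0 *: u) - f (h *: v + (t *: u + x)))) =
      (fun h0 => h0^-1 *: ((f \o shift (h *: v + (t *: u + x))) (h0 *: u)
        - f (h *: v + (t *: u + x)))).
    by apply/funext => k /=; rewrite addrCA.
  by apply: DeriveDef; rewrite /derivable /derive E//; exact: du.
have [s sh E] := @MVT_line F x u h (fun t th => @ex_derive _ _ _ _ _ _ _ (dF t th)).
have [t th E'] := @MVT_line ('D_u f) (s *: u + x) v h
  (fun t th => duv _ (eq_ind _ A (yd s t sh th) _ (addrCA _ _ _))).
exists (t *: v + (s *: u + x)); first by rewrite addrCA; exact: yd.
rewrite (@derive_val _ _ _ _ _ _ _ (dF s sh)) E' /F in E.
by rewrite expr2 -mulrA -E [h *: u + (h *: v + x)]addrCA; ring.
Unshelve. all: by end_near. Qed.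

(** Schwarz's theorem. One second difference equals [h ^+ 2] times either mixed derivative, at two
    different points [y] and [z]. If the values at [x] differed, continuity would keep each mixed
    derivative within half their distance of its own value, against their equality at [y] and
    [z]. *)
Lemma derive_comm f x u v :
  (\forall y \near x, [/\ derivable f y u, derivable f y v,
     derivable ('D_u f) y v & derivable ('D_v f) y u]) ->
  {for x, continuous ('D_v ('D_u f))} -> {for x, continuous ('D_u ('D_v f))} ->
  'D_v ('D_u f) x = 'D_u ('D_v f) x.
Proof.
move=> df cuv cvu; apply/eqP/negPn/negP => neq.
set p := 'D_v ('D_u f) x in neq; set q := 'D_u ('D_v f) x in neq.
have e0 : 0 < `|p - q| / 2 by rewrite divr_gt0// normr_gt0 subr_eq0.
have Np : \forall y \near x, `|p - 'D_v ('D_u f) y| < `|p - q| / 2.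
  by move/cvgrPdist_lt: cuv => /(_ _ e0).
have Nq : \forall y \near x, `|q - 'D_u ('D_v f) y| < `|p - q| / 2.
  by move/cvgrPdist_lt: cvu => /(_ _ e0).
have N : nbhs x [set y | [/\ derivable f y u, derivable f y v,
    derivable ('D_u f) y v & derivable ('D_v f) y u] /\
    (`|p - 'D_v ('D_u f) y| < `|p - q| / 2 /\
     `|q - 'D_u ('D_v f) y| < `|p - q| / 2)].
  exact: filterI df (filterI Np Nq).
have S1 : \forall h \near 0^'+, _ := @second_difference f x u v _ N
  (fun y Ny => let: conj (And4 a _ _ _) _ := Ny in a)
  (fun y Ny => let: conj (And4 _ _ a _) _ := Ny in a).
have S2 : \forall h \near 0^'+, _ := @second_difference f x v u _ N
  (fun y Ny => let: conj (And4 _ a _ _) _ := Ny in a)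
  (fun y Ny => let: conj (And4 _ _ _ a) _ := Ny in a).
have [h [h0 [[y [_ [yp _]] Ey] [z [_ [_ zq]] Ez]]]] :=
  filter_ex (filterI (nbhs_right_gt 0) (filterI S1 S2)).
have : h ^+ 2 * 'D_v ('D_u f) y = h ^+ 2 * 'D_u ('D_v f) z.
  apply: etrans (esym Ey) (etrans _ Ez).
  rewrite (addrCA (h *: u) (h *: v) x).
  by congr (_ + _); exact: addrAC.
move/(mulfI (lt0r_neq0 (exprn_gt0 2 h0))) => E; rewrite E in yp.
exact: not_halfway yp zq.
Qed.

End DirectionalDerivatives.

(** * Smooth functions on an open set *)

Section SmoothFunctions.
Variables (R : realType) (m : nat) (U : set 'rV[R]_m).
Hypothesis Uopen : open U.
Implicit Types (f g : 'rV[R]_m -> R) (x : 'rV[R]_m) (k : nat) (i : 'I_m).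

Lemma eq_partial f g x i : U x -> (forall y, U y -> f y = g y) ->
  partial i f x = partial i g x.
Proof.
move=> Ux fg; apply: near_eq_derive.
by apply: filterS (open_nbhs_nbhs (conj Uopen Ux)).
Qed.

Lemma eq_Ck k f g : (forall y, U y -> f y = g y) -> Ck k U f -> Ck k U g.
Proof.
elim: k f g => [|k IH] f g fg /=.
  move=> cf x xU; have Ux : U x by rewrite inE in xU.
  have NU : \forall y \near x, f y = g y.
    by apply: filterS (open_nbhs_nbhs (conj Uopen Ux)).
  rewrite /continuous_at -(fg _ Ux); apply: cvg_trans (cf x xU).
  exact: near_eq_cvg NU.
move=> [df cf]; split=> [i x Ux|i]; last first.
  by apply: IH (cf i) => y Uy; exact: eq_partial.
apply: near_eq_derivable (df i x Ux).
by apply: filterS (open_nbhs_nbhs (conj Uopen Ux)).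
Qed.

Lemma eq_smooth_on f g : (forall y, U y -> f y = g y) ->
  smooth_on U f -> smooth_on U g.
Proof. by move=> fg sf k; apply: eq_Ck fg (sf k). Qed.

Lemma smooth_continuous f x : smooth_on U f -> U x -> {for x, continuous f}.
Proof. by move=> /(_ 0%N) cf Ux; apply: cf; rewrite inE. Qed.

Lemma smooth_derivable f x i : smooth_on U f -> U x ->
  derivable f x (delta_mx 0 i).
Proof. by move=> /(_ 1%N) [df _] Ux; exact: df. Qed.

Lemma smooth_partial f i : smooth_on U f -> smooth_on U (partial i f).
Proof. by move=> sf k; have [_ H] := sf k.+1; exact: H. Qed.

Lemma smooth_cst (c : R) : smooth_on U (fun=> c).
Proof.
move=> k; elim: k c => [|k IH] c /=; first by move=> x _; exact: cst_continuous.
split=> [i x _|i]; first exact: derivable_cst.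
by apply: eq_Ck (IH 0) => y _; rewrite /partial derive_cst.
Qed.

Lemma Ck_add k f g : Ck k U f -> Ck k U g -> Ck k U (fun y => f y + g y).
Proof.
elim: k f g => [|k IH] f g /=.
  by move=> cf cg x xU; exact: (cvgD (cf x xU) (cg x xU)).
move=> [df cf] [dg cg]; split=> [i x Ux|i].
  by apply: derivableD; [exact: df|exact: dg].
apply: eq_Ck (IH _ _ (cf i) (cg i)) => y Uy.
exact: esym (deriveD (df i _ Uy) (dg i _ Uy)).
Qed.

(** The Leibniz rule involves [f] and [g] themselves at lower orders, and [Ck k.+1] does not
    literally contain [Ck k]; hence the hypotheses at every order up to [k]. *)
Lemma Ck_mul k f g : (forall j, (j <= k)%N -> Ck j U f) ->
  (forall j, (j <= k)%N -> Ck j U g) -> Ck k U (fun y => f y * g y).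
Proof.
elim: k f g => [|k IH] f g cf cg.
  by move=> x xU; exact: (cvgM (cf 0%N isT x xU) (cg 0%N isT x xU)).
have [df _] := cf 1%N isT; have [dg _] := cg 1%N isT.
have cpf i j : (j <= k)%N -> Ck j U (partial i f).
  by move=> jk; have [_ H] := cf j.+1 jk; exact: H.
have cpg i j : (j <= k)%N -> Ck j U (partial i g).
  by move=> jk; have [_ H] := cg j.+1 jk; exact: H.
have cfk j : (j <= k)%N -> Ck j U f by move=> /leqW; exact: cf.
have cgk j : (j <= k)%N -> Ck j U g by move=> /leqW; exact: cg.
split=> [i x Ux|i]; first by apply: derivableM; [exact: df|exact: dg].
apply: eq_Ck (Ck_add (IH _ _ (cpf i) cgk) (IH _ _ cfk (cpg i))) => y Uy.
rewrite addrC; apply: etrans (esym (deriveM (df i _ Uy) (dg i _ Uy))).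
by congr (_ + _); exact: mulrC.
Qed.

Lemma smooth_add f g : smooth_on U f -> smooth_on U g ->
  smooth_on U (fun y => f y + g y).
Proof. by move=> sf sg k; apply: Ck_add. Qed.

Lemma smooth_mul f g : smooth_on U f -> smooth_on U g ->
  smooth_on U (fun y => f y * g y).
Proof. by move=> sf sg k; apply: Ck_mul. Qed.

Lemma smooth_opp f : smooth_on U f -> smooth_on U (fun y => - f y).
Proof.
move=> sf; apply: eq_smooth_on (smooth_mul (smooth_cst (-1)) sf) => y _.
by rewrite mulN1r.
Qed.

(** The derivative of 1/f contains the square of 1/f, so the induction must carry all orders up to
    [k]. *)
Lemma smooth_inv f : (forall x, U x -> f x != 0) -> smooth_on U f ->
  smooth_on U (fun y => (f y)^-1).
Proof.
move=> f0 sf k.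
suff: forall j, (j <= k)%N -> Ck j U (fun y => (f y)^-1) by apply.
elim: k => [[] //= _ x xU|k IH j].
  have Ux : U x by rewrite inE in xU.
  exact: (cvgV (f0 _ Ux) (smooth_continuous sf Ux)).
case: (leqP j k) => [jk _|kj jk]; first exact: IH.
have -> : j = k.+1 by apply/eqP; rewrite eqn_leq jk.
split=> [i x Ux|i]; first by apply: derivableV; [exact: f0|exact: smooth_derivable].
have sp : forall j, (j <= k)%N -> Ck j U (fun y => - partial i f y).
  by move=> ? _; exact/smooth_opp/smooth_partial.
have I2 : forall j, (j <= k)%N -> Ck j U (fun y => (f y)^-1 * (f y)^-1).
  by move=> l lk; apply: Ck_mul => p pl; apply: IH; apply: leq_trans lk.
apply: eq_Ck (Ck_mul sp I2) => y Uy.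
rewrite /partial [RHS]deriveV ?f0//; last exact: smooth_derivable.
by rewrite -invfM -expr2 -[RHS]/(_ * _) mulrC mulrN -mulNr.
Qed.

Lemma smooth_sum (I : Type) (r : seq I) (P : pred I) (h : I -> 'rV[R]_m -> R) :
  (forall j, P j -> smooth_on U (h j)) ->
  smooth_on U (fun y => \sum_(j <- r | P j) h j y).
Proof.
move=> sh; elim: r => [|a r IH].
  by apply: eq_smooth_on (smooth_cst 0) => y _; rewrite big_nil.
case Pa : (P a).
  by apply: eq_smooth_on (smooth_add (sh _ Pa) IH) => y _; rewrite big_cons Pa.
by apply: eq_smooth_on IH => y _; rewrite big_cons Pa.
Qed.

Lemma smooth_prod (I : Type) (r : seq I) (P : pred I) (h : I -> 'rV[R]_m -> R) :
  (forall j, P j -> smooth_on U (h j)) ->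
  smooth_on U (fun y => \prod_(j <- r | P j) h j y).
Proof.
move=> sh; elim: r => [|a r IH].
  by apply: eq_smooth_on (smooth_cst 1) => y _; rewrite big_nil.
case Pa : (P a).
  by apply: eq_smooth_on (smooth_mul (sh _ Pa) IH) => y _; rewrite big_cons Pa.
by apply: eq_smooth_on IH => y _; rewrite big_cons Pa.
Qed.

Lemma partial_cst (c : R) i x : partial i (fun=> c) x = 0.
Proof. exact: derive_cst. Qed.

Lemma partialD f g i x : smooth_on U f -> smooth_on U g -> U x ->
  partial i (fun y => f y + g y) x = partial i f x + partial i g x.
Proof. by move=> sf sg Ux; apply: deriveD; exact: smooth_derivable. Qed.

Lemma partialN f i x : smooth_on U f -> U x ->
  partial i (fun y => - f y) x = - partial i f x.
Proof. by move=> sf Ux; apply: deriveN; exact: smooth_derivable. Qed.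

Lemma partialM f g i x : smooth_on U f -> smooth_on U g -> U x ->
  partial i (fun y => f y * g y) x = partial i f x * g x + f x * partial i g x.
Proof.
move=> sf sg Ux; rewrite [RHS]addrC.
rewrite /partial -[LHS]/('D_(delta_mx 0 i) (f * g) x).
rewrite (deriveM (smooth_derivable sf Ux) (smooth_derivable sg Ux)).
by congr (_ + _); exact: mulrC.
Qed.

Lemma partial_sum (I : Type) (r : seq I) (h : I -> 'rV[R]_m -> R) i x :
  (forall j, smooth_on U (h j)) -> U x ->
  partial i (fun y => \sum_(j <- r) h j y) x = \sum_(j <- r) partial i (h j) x.
Proof.
move=> sh Ux; elim: r => [|a r IH].
  rewrite big_nil -[RHS](partial_cst 0 i x); apply: eq_partial => // y _.
  by rewrite big_nil.
rewrite big_cons -IH -partialD//; last exact: smooth_sum.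
by apply: eq_partial => // y _; rewrite big_cons.
Qed.

Lemma partial_comm f i j x : smooth_on U f -> U x ->
  partial i (partial j f) x = partial j (partial i f) x.
Proof.
move=> sf Ux; apply: derive_comm.
- apply: filterS (open_nbhs_nbhs (conj Uopen Ux)) => y Uy.
  by split; apply: smooth_derivable => //; exact: smooth_partial.
- by apply: smooth_continuous => //; do 2![apply: smooth_partial].
- by apply: smooth_continuous => //; do 2![apply: smooth_partial].
Qed.

(** Induction on the expansion of [u] in basis vectors. Continuity of the partials replaces total
    differentiability. *)
Lemma derive_partials f x (u : 'rV[R]_m) : smooth_on U f -> U x ->
  'D_u f x = \sum_i u 0 i * partial i f x.
Proof.
move=> sf Ux; rewrite {1}(row_sum_delta u).
suff : forall r : seq 'I_m, is_derive x (\sum_(j <- r) u 0 j *: delta_mx 0 j) f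
    (\sum_(j <- r) u 0 j * partial j f x).
  by move=> H; exact: derive_val.
elim=> [|a r IH].
  have E : (fun h : R => h^-1 *: ((f \o shift x) (h *: 0) - f x)) = cst 0.
    by apply/funext => h /=; rewrite scaler0 add0r subrr scaler0.
  rewrite !big_nil; apply: DeriveDef; rewrite ?/derivable ?/derive E.
    exact: is_cvg_cst.
  exact: lim_cst.
(* [is_derive_dirD] wants derivability near [x] and continuity only for its second direction; the
   new basis vector is moved there, as the induction hypothesis is known at [x] alone. *)
rewrite !big_cons addrC [X in is_derive _ _ _ X]addrC.
have NU : forall y, U y -> is_derive y (u 0 a *: delta_mx 0 a) f
    (u 0 a * partial a f y).
  by move=> y Uy; apply: is_derive_dirZ; exact: smooth_derivable.
rewrite -(@derive_val _ _ _ _ _ _ _ (NU x Ux)) -(@derive_val _ _ _ _ _ _ _ IH).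
apply: is_derive_dirD => //.
  apply: filterS (open_nbhs_nbhs (conj Uopen Ux)) => y /NU dy.
  exact: (@ex_derive _ _ _ _ _ _ _ dy).
have sc := smooth_continuous
  (smooth_mul (smooth_cst (u 0 a)) (smooth_partial a sf)) Ux.
suff : 'D_(u 0 a *: delta_mx 0 a) f y @[y --> x] --> u 0 a * partial a f x.
  by rewrite -(@derive_val _ _ _ _ _ _ _ (NU x Ux)).
have NE : \forall y \near x,
    u 0 a * partial a f y = 'D_(u 0 a *: delta_mx 0 a) f y.
  apply: filterS (open_nbhs_nbhs (conj Uopen Ux)) => y /NU dy.
  by rewrite (@derive_val _ _ _ _ _ _ _ dy).
exact: cvg_trans (near_eq_cvg NE) sc.
Qed.

End SmoothFunctions.

(** * Smooth matrix-valued functions *)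

Section MatrixFunctions.
Variables (R : realType) (m : nat) (U : set 'rV[R]_m).
Hypothesis Uopen : open U.

Definition msmooth p q (F : 'rV[R]_m -> 'M[R]_(p, q)) : Prop :=
  forall i j, smooth_on U (fun y => F y i j).

Definition mpartial p q (k : 'I_m) (F : 'rV[R]_m -> 'M[R]_(p, q)) :
    'rV[R]_m -> 'M[R]_(p, q) :=
  fun x => \matrix_(i, j) partial k (fun y => F y i j) x.

Lemma mpartialE p q k (F : 'rV[R]_m -> 'M[R]_(p, q)) x i j :
  mpartial k F x i j = partial k (fun y => F y i j) x.
Proof. exact: mxE. Qed.

Lemma msmooth_cst p q (C : 'M[R]_(p, q)) : msmooth (fun=> C).
Proof. by move=> i j; exact: smooth_cst. Qed.

Lemma msmoothD p q (F G : 'rV[R]_m -> 'M[R]_(p, q)) :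
  msmooth F -> msmooth G -> msmooth (fun y => F y + G y).
Proof.
move=> sF sG i j; apply: eq_smooth_on (smooth_add Uopen (sF i j) (sG i j)) => //.
by move=> y _; rewrite mxE.
Qed.

Lemma msmoothN p q (F : 'rV[R]_m -> 'M[R]_(p, q)) :
  msmooth F -> msmooth (fun y => - F y).
Proof.
move=> sF i j; apply: eq_smooth_on (smooth_opp Uopen (sF i j)) => //.
by move=> y _; rewrite mxE.
Qed.

Lemma msmoothM p q r (F : 'rV[R]_m -> 'M[R]_(p, q))
    (G : 'rV[R]_m -> 'M[R]_(q, r)) :
  msmooth F -> msmooth G -> msmooth (fun y => F y *m G y).
Proof.
move=> sF sG i j.
have := @smooth_sum _ _ _ Uopen _ (index_enum 'I_q) xpredT
  (fun k y => F y i k * G y k j)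
  (fun k _ => smooth_mul Uopen (sF i k) (sG k j)).
by apply: eq_smooth_on => // y _; rewrite mxE.
Qed.

Lemma msmooth_tr p q (F : 'rV[R]_m -> 'M[R]_(p, q)) :
  msmooth F -> msmooth (fun y => (F y)^T).
Proof.
move=> sF i j; apply: eq_smooth_on (sF j i) => // y _.
by rewrite mxE.
Qed.

Lemma msmooth_partial p q k (F : 'rV[R]_m -> 'M[R]_(p, q)) :
  msmooth F -> msmooth (mpartial k F).
Proof.
move=> sF i j; apply: eq_smooth_on (@smooth_partial _ _ _ _ k (sF i j)) => // y _.
by rewrite mxE.
Qed.

Lemma smooth_det q (F : 'rV[R]_m -> 'M[R]_q) :
  msmooth F -> smooth_on U (fun y => \det (F y)).
Proof.
move=> sF; apply: smooth_sum => // s _; apply: smooth_mul => //.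
  exact: smooth_cst.
by apply: smooth_prod => // i _; exact: sF.
Qed.

(** Cramer's formula: the entries of the adjugate are polynomial in those of [F], and the
    determinant does not vanish on [U]. *)
Lemma msmooth_inv q (F : 'rV[R]_m -> 'M[R]_q) :
  (forall y, U y -> F y \in unitmx) ->
  msmooth F -> msmooth (fun y => invmx (F y)).
Proof.
move=> uF sF i j.
have sdet : smooth_on U (fun y => (\det (F y))^-1).
  apply: smooth_inv => //; last exact: smooth_det.
  by move=> y /uF; rewrite unitmxE unitfE.
have sadj : smooth_on U (fun y => \adj (F y) i j).
  have : smooth_on U (fun y => (-1) ^+ (j + i) * \det (row' j (col' i (F y)))).
    apply: smooth_mul => //; first exact: smooth_cst.
    apply: smooth_det => k l; apply: eq_smooth_on (sF (lift j k) (lift i l)) => //.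
    by move=> y _; rewrite !mxE.
  by apply: eq_smooth_on => // y _; rewrite mxE.
apply: eq_smooth_on (smooth_mul Uopen sdet sadj) => // y Uy.
by rewrite /invmx (uF _ Uy) [RHS]mxE.
Qed.

Lemma eq_mpartial p q k (F G : 'rV[R]_m -> 'M[R]_(p, q)) x :
  U x -> (forall y, U y -> F y = G y) -> mpartial k F x = mpartial k G x.
Proof.
move=> Ux FG; apply/matrixP => i j; rewrite !mxE.
by apply: eq_partial Ux _ => // y Uy; rewrite FG.
Qed.

Lemma mpartial_cst p q k (C : 'M[R]_(p, q)) x : mpartial k (fun=> C) x = 0.
Proof. by apply/matrixP => i j; rewrite !mxE partial_cst. Qed.

Lemma mpartialD p q k (F G : 'rV[R]_m -> 'M[R]_(p, q)) x :
  msmooth F -> msmooth G -> U x ->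
  mpartial k (fun y => F y + G y) x = mpartial k F x + mpartial k G x.
Proof.
move=> sF sG Ux; apply/matrixP => i j.
rewrite !mxE -(partialD k (sF i j) (sG i j))//.
by apply: eq_partial Ux _ => // y Uy; rewrite mxE.
Qed.

Lemma mpartialN p q k (F : 'rV[R]_m -> 'M[R]_(p, q)) x :
  msmooth F -> U x -> mpartial k (fun y => - F y) x = - mpartial k F x.
Proof.
move=> sF Ux; apply/matrixP => i j; rewrite !mxE -(partialN k (sF i j))//.
by apply: eq_partial Ux _ => // y Uy; rewrite mxE.
Qed.

Lemma mpartialM p q r k (F : 'rV[R]_m -> 'M[R]_(p, q))
    (G : 'rV[R]_m -> 'M[R]_(q, r)) x :
  msmooth F -> msmooth G -> U x ->
  mpartial k (fun y => F y *m G y) x =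
  mpartial k F x *m G x + F x *m mpartial k G x.
Proof.
move=> sF sG Ux; apply/matrixP => i j; rewrite !mxE.
transitivity (partial k (fun y => \sum_l F y i l * G y l j) x).
  by apply: eq_partial Ux _ => // y Uy; rewrite mxE.
rewrite (partial_sum Uopen _ _ _ Ux); last by move=> l; exact: smooth_mul.
rewrite -big_split/=; apply: eq_bigr => l _.
by rewrite !mxE (partialM _ (sF i l) (sG l j)).
Qed.

Lemma mpartial_tr p q k (F : 'rV[R]_m -> 'M[R]_(p, q)) x :
  mpartial k (fun y => (F y)^T) x = (mpartial k F x)^T.
Proof.
apply/matrixP => i j; rewrite !mxE; congr (partial k _ x).
by apply/funext => y; rewrite mxE.
Qed.

Lemma mpartial_comm p q k l (F : 'rV[R]_m -> 'M[R]_(p, q)) x :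
  msmooth F -> U x ->
  mpartial k (mpartial l F) x = mpartial l (mpartial k F) x.
Proof.
move=> sF Ux; apply/matrixP => i j; rewrite [LHS]mxE [RHS]mxE.
have E (a : 'I_m) : (fun y => mpartial a F y i j) = partial a (fun y => F y i j).
  by apply/funext => y; rewrite mxE.
by rewrite !E (partial_comm Uopen).
Qed.

End MatrixFunctions.

(** * The commuted-derivative identity *)

Lemma mxaddE (V : nmodType) p q (A B : 'M[V]_(p, q)) i j :
  (A + B) i j = A i j + B i j.
Proof. by rewrite mxE. Qed.

Lemma mxoppE (V : zmodType) p q (A : 'M[V]_(p, q)) i j : (- A) i j = - A i j.
Proof. by rewrite mxE. Qed.

Lemma mxzeroE (V : nmodType) p q i j : (0 : 'M[V]_(p, q)) i j = 0.
Proof. by rewrite mxE. Qed.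

Lemma row_entry (V : Type) p q (A : 'M[V]_(p, q)) i k j : row i A k j = A i j.
Proof. by rewrite mxE. Qed.

Lemma trmx_entry (V : Type) p q (A : 'M[V]_(p, q)) i j : A^T i j = A j i.
Proof. by rewrite mxE. Qed.

Lemma row_form (K : pzSemiRingType) p q (P : 'M[K]_(p, q)) (M : 'M[K]_q) k j :
  (row k P *m M *m (row j P)^T) 0 0 = (P *m M *m P^T) k j.
Proof.
rewrite -row_mul [LHS]mxE [RHS]mxE; apply: eq_bigr => l _.
by rewrite row_entry 2!trmx_entry row_entry.
Qed.

Lemma frame_mulKV (K : comUnitRingType) m (P G : 'M[K]_m) :
  P *m G *m P^T = 1%:M -> G *m P^T *m P = 1%:M.
Proof. by move=> PG; apply: mulmx1C; rewrite mulmxA. Qed.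

Lemma frame_unit (K : comUnitRingType) m (P G : 'M[K]_m) :
  P *m G *m P^T = 1%:M -> G \in unitmx.
Proof.
move=> /frame_mulKV E.
by have [] := @mulmx1_unit _ _ G (P^T *m P); rewrite ?mulmxA.
Qed.

(** The inverse metric is the sum of e_i (x) e_i over an orthonormal frame, the rows of [P]. Through
    this identity every index contraction with [invmx G] becomes a sum over the frame. *)
Lemma frame_mulV (K : comUnitRingType) m (P G : 'M[K]_m) :
  P *m G *m P^T = 1%:M -> P^T *m P = invmx G.
Proof.
move=> PG; rewrite -[LHS](mulKmx (frame_unit PG)) [G *m _]mulmxA.
by rewrite (frame_mulKV PG) mulmx1.
Qed.

(** * Curvature of a connection matrix, as formal algebra *)

Section CurvatureAlgebra.
Variables (S : comNzRingType) (m : nat).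

(* w *m curv C dC a b is R(d_a, d_b) w: endomorphisms act on row vectors, so
   the products appear in the order opposite to that of composition. *)
Definition curv q (C : 'I_m -> 'M[S]_q) (dC : 'I_m -> 'I_m -> 'M[S]_q) a b :=
  dC a b - dC b a + C b *m C a - C a *m C b.

Lemma curv_antisym q (C : 'I_m -> 'M[S]_q) dC a b : curv C dC b a = - curv C dC a b.
Proof.
by rewrite /curv; apply/matrixP => i j; rewrite !(mxaddE, mxoppE); ring.
Qed.

(** [dC i j] stands for the derivative of [C j] along d_i. The first hypothesis is torsion-freeness
    and the second its derivative; with them the terms cancel in pairs. *)
Lemma curv_bianchi (C : 'I_m -> 'M[S]_m) dC a b c :
  (forall i j, row j (C i) = row i (C j)) ->
  (forall i j k, row k (dC i j) = row j (dC i k)) ->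
  row c (curv C dC a b) + row a (curv C dC b c) + row b (curv C dC c a) = 0.
Proof.
move=> Cs dCs; rewrite /curv !raddfB !raddfD /= !raddfN /= !row_mul.
rewrite (dCs a b c) (dCs b a c) (dCs c a b) (Cs a c) (Cs b c) (Cs a b).
by apply/rowP => d; rewrite !(mxaddE, mxoppE, mxzeroE); ring.
Qed.

End CurvatureAlgebra.

(** * Commuting covariant derivatives of a matrix-valued field *)

Section Divergence.
Variables (S : comNzRingType) (m r : nat).
Variables (Gam : 'I_m -> 'M[S]_m) (dGam : 'I_m -> 'I_m -> 'M[S]_m).
Variables (A : 'I_m -> 'M[S]_r) (dA : 'I_m -> 'I_m -> 'M[S]_r).
Variables (F : 'M[S]_(r, m)) (dF : 'I_m -> 'M[S]_(r, m)).
Variables (ddF : 'I_m -> 'I_m -> 'M[S]_(r, m)).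
Variables (K : 'M[S]_(m, r)) (dK : 'I_m -> 'M[S]_(m, r)).

(** Covariant derivative of [F]: its column index is a vector index, handled by [Gam], and its row
    index lives in a rank [r] bundle with connection [A]. A vector field is [r = 1], [A = 0]; an
    endomorphism is [r = m], [A = Gam]. [dDF] is the Leibniz expansion of the derivative of [DF],
    with [d] and [dd] formal symbols. *)
Let DF a := dF a + F *m Gam a - A a *m F.
Let dDF a b := ddF a b + (dF a *m Gam b + F *m dGam a b)
  - (dA a b *m F + A b *m dF a).

(** The Christoffel correction on the derivative index is left out of both second derivatives: for a
    torsion-free connection it is symmetric in [a] and [b]. *)
Lemma ricci_identity a b : ddF a b = ddF b a ->
  F *m curv Gam dGam a b - curv A dA a b *m F =
  (dDF a b + DF b *m Gam a - A a *m DF b)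
  - (dDF b a + DF a *m Gam b - A b *m DF a).
Proof.
move=> Fab; rewrite /dDF /DF /curv Fab.
rewrite !(mulmxDl, mulmxDr, mulmxBl, mulmxBr, mulNmx, mulmxN) !mulmxA.
by apply/matrixP => i j; rewrite !(mxaddE, mxoppE); ring.
Qed.

(** Product rule for K^b nabla_b F^a: this field and the divergence of [F] vanish, and so do their
    derivatives, which are separate hypotheses since everything here is evaluated at one point. No
    integration is involved. *)
Lemma divergence_identity :
  (forall a b c, Gam a c b = Gam c a b) ->
  (forall a b, ddF a b = ddF b a) ->
  (forall c, \sum_a DF a c a = 0) ->
  (forall b c, \sum_a dDF b a c a = 0) ->
  (forall a, \sum_b (K *m DF b) b a = 0) ->
  (forall a, \sum_b (dK a *m DF b + K *m dDF a b) b a = 0) ->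
  \sum_a \sum_b (K *m (F *m curv Gam dGam a b - curv A dA a b *m F)) b a =
  - \sum_a \sum_b ((dK a + (Gam a)^T *m K + K *m A a) *m DF b) b a.
Proof.
move=> sGam sF divF ddivF V0 dV0.
have T1 : \sum_a \sum_b (K *m dDF a b) b a = - \sum_a \sum_b (dK a *m DF b) b a.
  apply/eqP; rewrite -addr_eq0 -big_split big1//= => a _.
  rewrite -big_split/= -[RHS](dV0 a); apply: eq_bigr => b _.
  by rewrite mxaddE addrC.
have T2 : \sum_a \sum_b (K *m DF b *m Gam a) b a = 0.
  apply: big1 => a _.
  under eq_bigr do rewrite mxE.
  rewrite exchange_big big1//= => d _.
  by rewrite -mulr_suml V0 mul0r.
have T4 : \sum_a \sum_b (K *m dDF b a) b a = 0.
  rewrite exchange_big big1//= => b _.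
  under eq_bigr do rewrite mxE.
  rewrite exchange_big big1//= => c _.
  by rewrite -mulr_sumr ddivF mulr0.
have T6 : \sum_a \sum_b (K *m A b *m DF a) b a = 0.
  rewrite exchange_big big1//= => b _.
  under eq_bigr do rewrite mxE.
  rewrite exchange_big big1//= => c _.
  by rewrite -mulr_sumr divF mulr0.
(* Torsion-freeness converts the Christoffel term on the vector index of [F] into the term
   [(Gam a)^T *m K] of nabla_a K. *)
have T5 : \sum_a \sum_b (K *m DF a *m Gam b) b a =
    \sum_a \sum_b ((Gam a)^T *m (K *m DF b)) b a.
  have E (a b : 'I_m) : (K *m DF a *m Gam b) b a =
      \sum_d Gam b d a * (K *m DF a) b d.
    by rewrite mxE; apply: eq_bigr => d _; rewrite mulrC.
  under eq_bigr do under eq_bigr do rewrite E.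
  under [RHS]eq_bigr do under eq_bigr do rewrite mxE.
  under eq_bigr do rewrite exchange_big/=.
  rewrite exchange_big /=; apply: eq_bigr => a _; apply: eq_bigr => b _.
  by apply: eq_bigr => d _; rewrite [(_^T) _ _]mxE sGam.
have E1 a b : (K *m (F *m curv Gam dGam a b - curv A dA a b *m F)) b a =
    (K *m dDF a b) b a + (K *m DF b *m Gam a) b a - (K *m A a *m DF b) b a
    - (K *m dDF b a) b a - (K *m DF a *m Gam b) b a + (K *m A b *m DF a) b a.
  rewrite ricci_identity// -!mulmxA -/(DF _) -/(dDF _ _).
  move: (dDF a b) (dDF b a) (DF b *m _) (DF a *m _) (A a *m _) (A b *m _).
  move=> X1 X2 X3 X4 X5 X6; rewrite !(mulmxDr, mulmxN) !(mxaddE, mxoppE); ring.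
under eq_bigr do under eq_bigr do rewrite E1.
under eq_bigr do rewrite !(big_split, sumrN)/=.
rewrite !(big_split, sumrN)/= T1 T2 T4 T5 T6.
have E2 a b : ((dK a + (Gam a)^T *m K + K *m A a) *m DF b) b a =
    (dK a *m DF b) b a + ((Gam a)^T *m (K *m DF b)) b a + (K *m A a *m DF b) b a.
  by rewrite !mulmxDl mulmxA !mxaddE.
under [in RHS]eq_bigr do under eq_bigr do rewrite E2.
under [in RHS]eq_bigr do rewrite !big_split/=.
by rewrite !big_split/=; ring.
Qed.

End Divergence.

(** In the second derivative of G antisymmetrised in [a] and [b], the left side vanishes and the
    right side is the curvature acting on both slots of G. *)
Lemma curv_metric (S : realFieldType) m (G : 'M[S]_m) (C : 'I_m -> 'M[S]_m)
    (dG : 'I_m -> 'M[S]_m) dC (ddG : 'I_m -> 'I_m -> 'M[S]_m) a b :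
  G^T = G -> (forall i, dG i = C i *m G + G *m (C i)^T) ->
  (forall i j, ddG i j = dC i j *m G + C j *m dG i
                         + (dG i *m (C j)^T + G *m (dC i j)^T)) ->
  ddG a b = ddG b a ->
  (curv C dC a b *m G)^T = - (curv C dC a b *m G).
Proof.
move=> Gs dGE ddGE; rewrite !ddGE !dGE trmx_mul Gs /curv.
rewrite !(raddfB, raddfD, raddfN) /= !trmx_mul.
rewrite !(mulmxDl, mulmxDr, mulNmx, mulmxN, mulmxBl, mulmxBr) !mulmxA.
move=> /matrixP E; apply/matrixP => i j; move: (E i j).
by rewrite !(mxaddE, mxoppE); lra.
Qed.

(** * Pointwise algebra in an orthonormal frame *)

Section AdaptedFrame.
Variables (K : realFieldType) (m : nat).
(** In an orthonormal frame: [W] is omega, and also J; [a] is alpha; [A i] and [T i] are nabla_i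
    alpha and nabla_i omega. [dWW], [daW] and [A_orth] are the derivatives of [WW], [aW] and
    [a_unit]; [A_sym] is d alpha = 0 and [T_cyc] is d omega = 0. *)
Variables (W : 'M[K]_m) (a : 'rV[K]_m) (A : 'I_m -> 'rV[K]_m) (T : 'I_m -> 'M[K]_m).
Hypothesis (W_anti : W^T = - W) (T_anti : forall i, (T i)^T = - T i).
Hypothesis (WW : W *m W = a^T *m a - 1%:M) (aW : a *m W = 0).
Hypothesis (a_unit : a *m a^T = 1%:M).
Hypothesis (dWW : forall i, T i *m W + W *m T i = (A i)^T *m a + a^T *m A i).
Hypothesis (daW : forall i, A i *m W + a *m T i = 0).
Hypothesis (A_orth : forall i, A i *m a^T = 0).
Hypothesis (A_sym : forall i j, A i 0 j = A j 0 i).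
Hypothesis (T_cyc : forall i j k, T i j k + T j k i + T k i j = 0).

Let W_swap i j : W j i = - W i j.
Proof. by rewrite -mxoppE -W_anti mxE. Qed.

Let T_swap i j k : T i k j = - T i j k.
Proof. by rewrite -mxoppE -T_anti mxE. Qed.

Lemma trace_rank1 (u v : 'rV[K]_m) : \tr (u^T *m v) = (v *m u^T) 0 0.
Proof. by rewrite mxtrace_mulC [\tr _]big_ord1. Qed.

(** The length of omega is constant: the trace of [dWW] reduces to products of [A i] with [a], which
    vanish. *)
Lemma trace_WT i : \tr (W *m T i) = 0.
Proof.
have : \tr (T i *m W + W *m T i) = 0.
  have aA : a *m (A i)^T = 0.
    by rewrite -[LHS]trmxK trmx_mul trmxK A_orth trmx0.
  by rewrite dWW mxtraceD !trace_rank1 A_orth aA mxE addr0.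
by rewrite mxtraceD mxtrace_mulC; lra.
Qed.

(** [T_cyc] contracted with [W]: one of the three terms is [trace_WT], the other two coincide. *)
Lemma contract_WT l : \sum_i \sum_k W i k * T i k l = 0.
Proof.
have E1 : \sum_i \sum_k W i k * T l i k = 0.
  transitivity (- \tr (W *m T l)); last by rewrite trace_WT oppr0.
  rewrite /mxtrace -sumrN; apply: eq_bigr => i _.
  rewrite mxE -sumrN; apply: eq_bigr => k _.
  by rewrite [T l k i]T_swap mulrN opprK.
have E2 : \sum_i \sum_k W i k * T k l i = \sum_i \sum_k W i k * T i k l.
  rewrite exchange_big/=; apply: eq_bigr => i _; apply: eq_bigr => k _.
  by rewrite W_swap T_swap; ring.
have : \sum_i \sum_k W i k * (T l i k + T i k l + T k l i) = 0.
  by apply: big1 => i _; apply: big1 => k _; rewrite T_cyc mulr0.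
under eq_bigr do under eq_bigr do rewrite !mulrDr.
under eq_bigr do rewrite !big_split/=.
by rewrite !big_split/= E1 E2; lra.
Qed.

(** The divergence of omega, its codifferential up to sign. *)
Let delta : 'rV[K]_m := \row_k \sum_j T j j k.

(** [dWW] contracted over the derivative index and the row index. One term on the left is
    [contract_WT]; on the right the derivative of alpha along [a] vanishes by [A_sym] and
    [A_orth]. *)
Let deltaW : delta *m W = (\sum_j A j 0 j) *: a.
Proof.
apply/rowP => l; rewrite !mxE.
have H j : \sum_k T j j k * W k l + \sum_k W j k * T j k l =
    A j 0 j * a 0 l + a 0 j * A j 0 l.
  have := congr1 (fun M : 'M[K]_m => M j l) (dWW j).
  by rewrite !mxE !big_ord1 !mxE.
have : \sum_j (\sum_k T j j k * W k l + \sum_k W j k * T j k l) =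
    \sum_j (A j 0 j * a 0 l + a 0 j * A j 0 l).
  by apply: eq_bigr => j _; rewrite H.
rewrite !big_split/= contract_WT addr0 -mulr_suml.
have -> : \sum_j a 0 j * A j 0 l = 0.
  have := congr1 (fun M : 'M[K]_1 => M 0 0) (A_orth l); rewrite !mxE => E.
  by rewrite -[RHS]E; apply: eq_bigr => j _; rewrite !mxE A_sym mulrC.
rewrite addr0 => <-; rewrite exchange_big /=; apply: eq_bigr => k _.
by rewrite mxE mulr_suml.
Qed.

(** Pairing [deltaW] with [a] kills its left side, because [W] annihilates [a]. *)
Lemma trace_A : \sum_i A i 0 i = 0.
Proof.
have Wa : W *m a^T = 0.
  by rewrite -[W]opprK -W_anti mulNmx -trmx_mul aW trmx0 oppr0.
have := congr1 (fun M => M *m a^T) deltaW.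
rewrite -mulmxA Wa mulmx0 -scalemxAl a_unit => /matrixP/(_ 0 0).
by rewrite !mxE mulr1.
Qed.

(** With [trace_A], [deltaW] says that [delta] is in the kernel of [W], hence a multiple of [a]. Its
    component along [a] is, by [daW], a contraction of the symmetric [A] with the antisymmetric [W],
    hence zero. *)
Lemma contract_T k : \sum_j T j j k = 0.
Proof.
have da : delta *m a^T = 0.
  apply/matrixP => i0 j0; rewrite !ord1 !mxE.
  have H j : \sum_l A j 0 l * W l j + \sum_l a 0 l * T j l j = 0.
    by have := congr1 (fun M : 'rV[K]_m => M 0 j) (daW j); rewrite !mxE.
  have S : \sum_j \sum_l A j 0 l * W l j = 0.
    set s := LHS; have : s = - s.
      rewrite /s [LHS]exchange_big -sumrN/=; apply: eq_bigr => i _.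
      rewrite -sumrN; apply: eq_bigr => j _.
      by rewrite A_sym W_swap mulrN.
    by lra.
  have : \sum_j (\sum_l A j 0 l * W l j + \sum_l a 0 l * T j l j) = 0.
    by apply: big1 => j _.
  rewrite big_split/= S add0r => E.
  rewrite -[RHS]oppr0 -[in RHS]E exchange_big -sumrN; apply: eq_bigr => l _.
  rewrite !mxE mulr_suml -sumrN; apply: eq_bigr => j _.
  by rewrite T_swap; ring.
have : delta *m W *m W = 0 by rewrite deltaW trace_A scale0r mul0mx.
rewrite -mulmxA WW mulmxBr mulmxA da mul0mx mulmx1 sub0r.
by move=> /eqP; rewrite oppr_eq0 => /eqP/rowP/(_ k); rewrite !mxE.
Qed.

(** Multiply [T_cyc] by [T i j k] and sum: the square appears once and the mixed product twice. *)
Lemma sum_sq_cyc :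
  - \sum_i \sum_j \sum_k T k i j * T i j k =
  2^-1 * \sum_i \sum_j \sum_k T i j k ^+ 2.
Proof.
have : \sum_i \sum_j \sum_k (T i j k + T j k i + T k i j) * T i j k = 0.
  by apply: big1 => i _; apply: big1 => j _; apply: big1 => k _; rewrite T_cyc mul0r.
under eq_bigr do under eq_bigr do under eq_bigr do rewrite !mulrDl -expr2.
under eq_bigr do under eq_bigr do rewrite !big_split/=.
under eq_bigr do rewrite !big_split/=.
rewrite !big_split/=.
have -> : \sum_i \sum_j \sum_k T j k i * T i j k =
    \sum_i \sum_j \sum_k T k i j * T i j k.
  rewrite exchange_big/=; apply: eq_bigr => i _.
  rewrite exchange_big/=; apply: eq_bigr => j _; apply: eq_bigr => k _.
  by rewrite mulrC.
lra.
Qed.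

(* |S - (a^T b - b^T a)|^2 >= 0 with b = a S. *)
Lemma anti_norm_bound (S : 'M[K]_m) : S^T = - S ->
  ((a *m S) *m (a *m S)^T) 0 0 <= 2^-1 * \sum_j \sum_k S j k ^+ 2.
Proof.
move=> S_anti; set b := a *m S.
have Sa : S *m a^T = - b^T by rewrite -[S]opprK -S_anti mulNmx -trmx_mul.
have ba : (b *m a^T) 0 0 = 0.
  have : (b *m a^T)^T = - (b *m a^T).
    by rewrite trmx_mul trmxK /b trmx_mul S_anti mulNmx mulmxN mulmxA.
  by move=> /matrixP/(_ 0 0); rewrite mxE mxoppE; lra.
have normE (Q : 'M[K]_m) : \tr (Q *m Q^T) = \sum_j \sum_k Q j k ^+ 2.
  rewrite /mxtrace; apply: eq_bigr => j _; rewrite mxE; apply: eq_bigr => k _.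
  by rewrite mxE.
rewrite -normE.
pose Q := S - (a^T *m b - b^T *m a).
have Q0 : 0 <= \tr (Q *m Q^T).
  by rewrite normE; do 2!(apply: sumr_ge0 => ? _); exact: sqr_ge0.
(* Antisymmetry turns the norm of [Q] into traces of products; the rank one formulas [r1] and [r2]
   evaluate them to |S|^2 - 2 |b|^2. *)
have Q_anti : Q^T = - Q.
  rewrite /Q !raddfB/= !trmx_mul !trmxK S_anti.
  by apply/matrixP=> i j; rewrite !(mxaddE, mxoppE); ring.
have ab : (a *m b^T) 0 0 = 0.
  by rewrite -ba -[a *m b^T]trmxK trmx_mul trmxK mxE.
have aa : (a *m a^T) 0 0 = 1 by rewrite a_unit mxE.
move: Q0; rewrite Q_anti S_anti !mulmxN !raddfN /= /Q.
rewrite !(mulmxBl, mulmxBr) !raddfB /=.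
have r1 (u v x y : 'rV[K]_m) : \tr ((u^T *m v) *m (x^T *m y)) =
    (v *m x^T) 0 0 * (y *m u^T) 0 0.
  rewrite mulmxA -[u^T *m v *m _]mulmxA; move: (v *m x^T) => c.
  by rewrite {1}[c]mx11_scalar mul_mx_scalar -scalemxAl linearZ /= trace_rank1.
have r2 (u v : 'rV[K]_m) : \tr ((u^T *m v) *m S) = (v *m S *m u^T) 0 0.
  by rewrite -mulmxA trace_rank1.
rewrite ![\tr (S *m (_ *m _))]mxtrace_mulC !r1 !r2.
rewrite aa ab ba -/b.
have -> : (b *m S *m a^T) 0 0 = - (b *m b^T) 0 0.
  by rewrite -mulmxA Sa mulmxN mxE.
lra.
Qed.

(** By [daW], [a *m T i] is [- (A i *m W)], of the same length as [A i], since [W] is an isometry on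
    the orthogonal complement of [a]. Then [anti_norm_bound] applies to each [T i]. *)
Lemma sum_A_le : \sum_i \sum_j A i 0 j ^+ 2 <=
  2^-1 * \sum_i \sum_j \sum_k T i j k ^+ 2.
Proof.
rewrite mulr_sumr; apply: ler_sum => i _.
apply: le_trans (anti_norm_bound (T_anti i)).
have -> : a *m T i = - (A i *m W).
  by apply/eqP; rewrite -addr_eq0 addrC daW.
rewrite mulNmx [(- _)^T]raddfN /= mulmxN opprK trmx_mul W_anti mulNmx mulmxN.
rewrite mulmxA -[A i *m W *m W]mulmxA WW mulmxBr mulmxA A_orth mul0mx sub0r.
rewrite mulmx1 mulNmx opprK mxE.
by apply: ler_sum => j _; rewrite mxE expr2.
Qed.

End AdaptedFrame.

(** * From chart components to an orthonormal frame at one point *)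

Section FrameChange.
Variables (K : realFieldType) (m : nat) (P G : 'M[K]_m).
Variables (Om : 'M[K]_m) (al : 'rV[K]_m).
Variables (Dal : 'I_m -> 'rV[K]_m) (Dom : 'I_m -> 'M[K]_m).
Let H := invmx G.
Hypothesis P_orth : P *m G *m P^T = 1%:M.
Hypothesis (Om_anti : Om^T = - Om).
Hypothesis (OHO : Om *m H *m Om = al^T *m al - G) (alO : al *m H *m Om = 0).
Hypothesis (al_unit : al *m H *m al^T = 1%:M).
Hypothesis (Dom_anti : forall i, (Dom i)^T = - Dom i).
Hypothesis (dOHO : forall i, Dom i *m H *m Om + Om *m H *m Dom i =
  (Dal i)^T *m al + al^T *m Dal i).
Hypothesis (dalO : forall i, Dal i *m H *m Om + al *m H *m Dom i = 0).
Hypothesis (Dal_orth : forall i, Dal i *m H *m al^T = 0).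
Hypothesis (Dal_sym : forall i j, Dal i 0 j = Dal j 0 i).
Hypothesis (Dom_cyc : forall i j k, Dom i j k + Dom j k i + Dom k i j = 0).

Let PP1 : G *m P^T *m P = 1%:M.
Proof. exact: frame_mulKV. Qed.

Let PP : P^T *m P = H.
Proof. exact: frame_mulV. Qed.

(** Change of the derivative index only: from the component along d_c to that along the frame vector
    [row i P]. The other indices are changed by products with [P] and [P^T]. *)
Definition frame_sum p q (X : 'I_m -> 'M[K]_(p, q)) i := \sum_c P i c *: X c.

Lemma frame_sumMl p q r (M : 'M[K]_(r, p)) (X : 'I_m -> 'M[K]_(p, q)) i :
  frame_sum (fun c => M *m X c) i = M *m frame_sum X i.
Proof. by rewrite mulmx_sumr; apply: eq_bigr => c _; rewrite scalemxAr. Qed.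

Lemma frame_sumMr p q r (M : 'M[K]_(q, r)) (X : 'I_m -> 'M[K]_(p, q)) i :
  frame_sum (fun c => X c *m M) i = frame_sum X i *m M.
Proof. by rewrite mulmx_suml; apply: eq_bigr => c _; rewrite scalemxAl. Qed.

Lemma frame_sumD p q (X Y : 'I_m -> 'M[K]_(p, q)) i :
  frame_sum (fun c => X c + Y c) i = frame_sum X i + frame_sum Y i.
Proof. by rewrite -big_split; apply: eq_bigr => c _; rewrite scalerDr. Qed.

Lemma frame_sumT p q (X : 'I_m -> 'M[K]_(p, q)) i :
  frame_sum (fun c => (X c)^T) i = (frame_sum X i)^T.
Proof.
rewrite raddf_sum; apply: eq_bigr => c _.
by apply/matrixP => k l; rewrite !mxE.
Qed.

Lemma frame_sumE p q (X : 'I_m -> 'M[K]_(p, q)) i j k :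
  frame_sum X i j k = \sum_c P i c * X c j k.
Proof. by rewrite summxE; apply: eq_bigr => c _; rewrite mxE. Qed.

Lemma eq_frame_sum p q (X Y : 'I_m -> 'M[K]_(p, q)) i :
  (forall c, X c = Y c) -> frame_sum X i = frame_sum Y i.
Proof. by move=> XY; apply: eq_bigr => c _; rewrite XY. Qed.

Let W := P *m Om *m P^T.
Let a := al *m P^T.
Let A := frame_sum (fun c => Dal c *m P^T).
Let T := frame_sum (fun c => P *m Dom c *m P^T).

Let conjM (X Y : 'M[K]_m) :
  (P *m X *m P^T) *m (P *m Y *m P^T) = P *m (X *m H *m Y) *m P^T.
Proof. by rewrite !mulmxA -[P *m X *m P^T *m P]mulmxA PP. Qed.

Let rowM (x : 'rV[K]_m) (Y : 'M[K]_m) :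
  (x *m P^T) *m (P *m Y *m P^T) = (x *m H *m Y) *m P^T.
Proof. by rewrite !mulmxA -[x *m P^T *m P]mulmxA PP. Qed.

Let T_E i : T i = P *m frame_sum Dom i *m P^T.
Proof. by rewrite /T (frame_sumMr P^T (fun c => P *m Dom c)) frame_sumMl. Qed.

Let A_E i : A i = frame_sum Dal i *m P^T.
Proof. by rewrite /A frame_sumMr. Qed.

Let W_anti : W^T = - W.
Proof. by rewrite /W !trmx_mul trmxK Om_anti mulNmx mulmxN mulmxA. Qed.

Let T_anti i : (T i)^T = - T i.
Proof.
rewrite -frame_sumT /T /frame_sum -sumrN; apply: eq_bigr => c _.
by rewrite !trmx_mul trmxK Dom_anti mulNmx mulmxN mulmxA scalerN.
Qed.

Let WW : W *m W = a^T *m a - 1%:M.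
Proof.
rewrite conjM OHO mulmxBr mulmxBl P_orth.
by rewrite /a trmx_mul trmxK !mulmxA.
Qed.

Let aW : a *m W = 0.
Proof. by rewrite rowM alO mul0mx. Qed.

Let a_unit : a *m a^T = 1%:M.
Proof. by rewrite /a trmx_mul trmxK mulmxA -[al *m P^T *m P]mulmxA PP. Qed.

Let dWW i : T i *m W + W *m T i = (A i)^T *m a + a^T *m A i.
Proof.
have E : frame_sum Dom i *m H *m Om + Om *m H *m frame_sum Dom i =
    (frame_sum Dal i)^T *m al + al^T *m frame_sum Dal i.
  rewrite -frame_sumT -!frame_sumMr -!frame_sumMl -!frame_sumD.
  exact: eq_frame_sum.
rewrite T_E A_E !conjM -mulmxDl -mulmxDr E mulmxDr mulmxDl.
by rewrite /a !trmx_mul trmxK !mulmxA.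
Qed.

Let daW i : A i *m W + a *m T i = 0.
Proof.
have E : frame_sum Dal i *m H *m Om + al *m H *m frame_sum Dom i = 0.
  rewrite -!frame_sumMr -!frame_sumMl -!frame_sumD.
  by rewrite (eq_frame_sum _ dalO) /frame_sum big1// => c _; rewrite scaler0.
by rewrite T_E A_E !rowM -mulmxDl E mul0mx.
Qed.

Let A_orth i : A i *m a^T = 0.
Proof.
rewrite A_E /a trmx_mul trmxK mulmxA -[_ *m P^T *m P]mulmxA PP -!frame_sumMr.
by rewrite (eq_frame_sum _ Dal_orth) /frame_sum big1// => c _; rewrite scaler0.
Qed.

Let A_entry i j : A i 0 j = \sum_c \sum_d P i c * P j d * Dal c 0 d.
Proof.
rewrite frame_sumE; apply: eq_bigr => c _; rewrite mxE mulr_sumr.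
by apply: eq_bigr => d _; rewrite mxE; ring.
Qed.

Let A_sym i j : A i 0 j = A j 0 i.
Proof.
rewrite !A_entry exchange_big; apply: eq_bigr => c _; apply: eq_bigr => d _.
by rewrite Dal_sym; ring.
Qed.

Let T_entry i j k : T i j k =
  \sum_c \sum_d \sum_e P i c * P j d * P k e * Dom c d e.
Proof.
rewrite frame_sumE; apply: eq_bigr => c _; rewrite mxE mulr_sumr exchange_big/=.
apply: eq_bigr => e _; rewrite !mxE mulr_suml mulr_sumr.
by apply: eq_bigr => d _; ring.
Qed.

Let T_cyc i j k : T i j k + T j k i + T k i j = 0.
Proof.
have -> : T j k i = \sum_c \sum_d \sum_e P i c * P j d * P k e * Dom d e c.
  rewrite T_entry; under eq_bigr do rewrite exchange_big/=.
  rewrite exchange_big/=; apply: eq_bigr => c _; apply: eq_bigr => d _.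
  by apply: eq_bigr => e _; ring.
have -> : T k i j = \sum_c \sum_d \sum_e P i c * P j d * P k e * Dom e c d.
  rewrite T_entry exchange_big/=; apply: eq_bigr => c _.
  rewrite exchange_big/=; apply: eq_bigr => d _.
  by apply: eq_bigr => e _; ring.
rewrite T_entry -!big_split/= big1// => c _; rewrite -!big_split/= big1// => d _.
by rewrite -!big_split/= big1// => e _; rewrite -!mulrDr Dom_cyc mulr0.
Qed.

Lemma div_al0 : \sum_c (Dal c *m H) 0 c = 0.
Proof.
rewrite -[RHS](trace_A W_anti T_anti aW a_unit dWW A_orth A_sym T_cyc).
under [RHS]eq_bigr do rewrite frame_sumE.
rewrite [RHS]exchange_big/=; apply: eq_bigr => c _; rewrite -PP mulmxA mxE.
by apply: eq_bigr => i _; rewrite mulrC.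
Qed.

(** The free index [d] is moved to the frame by the invertible [P], where the sum is the one of
    [contract_T] up to sign. *)
Lemma div_om0 d : \sum_c (Dom c *m H) d c = 0.
Proof.
pose v : 'cV[K]_m := \col_d \sum_c (Dom c *m H) d c.
have Pv : P *m v = 0.
  apply/matrixP => j j0; rewrite !mxE.
  under eq_bigr do rewrite mxE mulr_sumr.
  rewrite exchange_big/=.
  transitivity (\sum_c (P *m Dom c *m P^T *m P) j c).
    apply: eq_bigr => c _; rewrite -!mulmxA PP [RHS]mxE; exact: eq_bigr.
  under eq_bigr do rewrite mxE.
  rewrite exchange_big/=.
  transitivity (\sum_i T i j i).
    apply: eq_bigr => i _; rewrite frame_sumE; apply: eq_bigr => c _.
    by rewrite mulrC.
  transitivity (- \sum_i T i i j); last first.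
    rewrite (contract_T W_anti T_anti WW aW a_unit dWW daW A_orth A_sym T_cyc).
    exact: oppr0.
  rewrite -sumrN; apply: eq_bigr => i _.
  by rewrite -mxoppE -T_anti mxE.
have v0 : v = 0.
  have -> : v = G *m P^T *m (P *m v) by rewrite mulmxA PP1 mul1mx.
  by rewrite Pv mulmx0.
by move/colP: v0 => /(_ d); rewrite !mxE.
Qed.

Lemma om_div0 d : \sum_c (H *m Om *m H *m Dom c *m H) c d = 0.
Proof.
have E c : (H *m Om *m H *m Dom c *m H) c d =
    \sum_i P i c * (W *m (P *m Dom c *m P^T) *m P) i d.
  have -> : H *m Om *m H *m Dom c *m H =
      P^T *m (W *m (P *m Dom c *m P^T) *m P) by rewrite -PP /W !mulmxA.
  by rewrite mxE; apply: eq_bigr => i _; rewrite mxE.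
under eq_bigr do rewrite E.
rewrite exchange_big/=.
transitivity (\sum_i \sum_l (\sum_k W i k * T i k l) * P l d).
  apply: eq_bigr => i _.
  transitivity ((W *m T i *m P) i d).
    rewrite -(frame_sumMl W (fun c => P *m Dom c *m P^T)) -frame_sumMr frame_sumE.
    exact: eq_bigr.
  by rewrite mxE; apply: eq_bigr => l _; rewrite mxE.
rewrite exchange_big big1//= => l _; rewrite -mulr_suml.
by rewrite (contract_WT W_anti T_anti dWW A_orth T_cyc) mul0r.
Qed.

(** The outer factors [P^T] and [P] are the halves of the two inverse metrics that contract the
    derivative indices; their other halves form the two frame sums. *)
Lemma frame_contract r (X : 'I_m -> 'M[K]_(m, r)) (Y : 'I_m -> 'M[K]_(r, m)) :
  \sum_c \sum_d (P^T *m X c *m (Y d *m P)) d c =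
  \sum_i \sum_j (frame_sum X i *m frame_sum Y j) j i.
Proof.
have E c d : (P^T *m X c *m (Y d *m P)) d c =
    \sum_i \sum_j P i c * (P j d * (X c *m Y d) j i).
  rewrite !mulmxA mxE; apply: eq_bigr => i _.
  rewrite -mulmxA mxE mulr_suml; apply: eq_bigr => j _; rewrite !mxE; ring.
under eq_bigr do under eq_bigr do rewrite E.
under eq_bigr do rewrite exchange_big/=.
rewrite exchange_big/=; apply: eq_bigr => i _.
under eq_bigr do rewrite exchange_big/=.
rewrite exchange_big/=; apply: eq_bigr => j _.
rewrite -frame_sumMr frame_sumE; apply: eq_bigr => c _.
by rewrite -frame_sumMl frame_sumE mulr_sumr.
Qed.

Let contract_Dal : \sum_c \sum_d ((Dal c *m H)^T *m (Dal d *m H)) d c =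
  \sum_i \sum_j A i 0 j ^+ 2.
Proof.
transitivity (\sum_i \sum_j
    (frame_sum (fun c => (Dal c *m P^T)^T) i *m A j) j i); last first.
  apply: eq_bigr => i _; apply: eq_bigr => j _.
  by rewrite frame_sumT mxE big_ord1 mxE A_sym expr2.
rewrite -frame_contract; apply: eq_bigr => c _; apply: eq_bigr => d _.
by rewrite -PP !trmx_mul !trmxK !mulmxA.
Qed.

Let contract_Dom : \sum_c \sum_d (H *m Dom c *m H *m Dom d *m H) d c =
  \sum_i \sum_j \sum_k T k i j * T i j k.
Proof.
transitivity (\sum_k \sum_i (T k *m T i) i k).
  rewrite -frame_contract; apply: eq_bigr => c _; apply: eq_bigr => d _.
  by rewrite -PP !mulmxA.
rewrite exchange_big/=; apply: eq_bigr => i _.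
rewrite [RHS]exchange_big/=; apply: eq_bigr => k _.
by rewrite mxE.
Qed.

(** The sum is |nabla alpha|^2. Since alpha is closed, its kernel is tangent to hypersurfaces, and
    nabla alpha is up to sign their second fundamental form. *)
Lemma second_fundamental_ge0 :
  0 <= \sum_c \sum_d ((Dal c *m H)^T *m (Dal d *m H)) d c.
Proof.
rewrite contract_Dal; apply: sumr_ge0 => i _; apply: sumr_ge0 => j _.
exact: sqr_ge0.
Qed.

Lemma second_fundamental_le :
  \sum_c \sum_d ((Dal c *m H)^T *m (Dal d *m H)) d c <=
  - \sum_c \sum_d (H *m Dom c *m H *m Dom d *m H) d c.
Proof.
rewrite contract_Dal contract_Dom (sum_sq_cyc T_cyc).
exact: (sum_A_le W_anti T_anti WW a_unit daW A_orth).
Qed.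

End FrameChange.

(** * The Levi-Civita connection in a chart *)

Section LeviCivita.
Variables (R : realType) (m : nat) (U : set 'rV[R]_m).
Hypothesis Uopen : open U.
Variable G : 'rV[R]_m -> 'M[R]_m.
Hypothesis sG : msmooth U G.
Hypothesis G_sym : forall y, U y -> (G y)^T = G y.
Hypothesis G_unit : forall y, U y -> G y \in unitmx.
Let H y := invmx (G y).

(* The matrix of v |-> nabla_(d_k) v on constant fields v. *)
Definition gam (G : 'rV[R]_m -> 'M[R]_m) (k : 'I_m) (y : 'rV[R]_m) : 'M[R]_m :=
  \matrix_(i, j) christoffel G j k i y.

Lemma near_in y (Q : 'rV[R]_m -> Prop) : U y -> (forall z, U z -> Q z) ->
  \forall z \near y, Q z.
Proof. by move=> Uy UQ; apply: filterS (open_nbhs_nbhs (conj Uopen Uy)). Qed.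

Lemma gam_sym y i j k : U y -> gam G i y j k = gam G j y i k.
Proof.
by move=> Uy; rewrite !mxE; apply: christoffel_sym; exact: near_in Uy G_sym.
Qed.

Lemma mpartial_metric y k : U y ->
  mpartial k G y = gam G k y *m G y + G y *m (gam G k y)^T.
Proof.
move=> Uy; apply/matrixP => i j; rewrite !mxE.
rewrite (christoffel_metric _ _ _ (near_in Uy G_sym))//; last exact: G_unit.
by congr (_ + _); apply: eq_bigr => l _; rewrite !mxE// mulrC.
Qed.

Lemma msmooth_invG : msmooth U H.
Proof. exact: msmooth_inv. Qed.

Lemma msmooth_gam k : msmooth U (gam G k).
Proof.
move=> i j.
have : smooth_on U (christoffel G j k i).
  apply: smooth_mul => //; first exact: smooth_cst.
  apply: smooth_sum => // l _; apply: smooth_mul => //; first exact: msmooth_invG.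
  apply: smooth_add => //; last by apply: smooth_opp => //; exact: smooth_partial.
  by apply: smooth_add => //; exact: smooth_partial.
by apply: eq_smooth_on => // y _; rewrite mxE.
Qed.

(** The inverse metric is parallel: differentiate [G *m H = 1%:M] and use metric compatibility. *)
Lemma mpartial_invG y k : U y ->
  mpartial k H y = - ((gam G k y)^T *m H y + H y *m gam G k y).
Proof.
move=> Uy; have uG := G_unit Uy.
have E : mpartial k G y *m H y + G y *m mpartial k H y = 0.
  rewrite -(mpartialM Uopen k sG msmooth_invG Uy).
  rewrite (eq_mpartial (G := fun=> 1%:M) Uopen _ Uy) ?mpartial_cst// => z Uz.
  by rewrite mulmxV// G_unit.
rewrite -[LHS](mulKmx uG) -/(H y).
have -> : G y *m mpartial k H y = - (mpartial k G y *m H y).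
  by apply/eqP; rewrite -addr_eq0 addrC E.
rewrite mpartial_metric// mulmxN; congr (- _).
rewrite mulmxDl mulmxDr -!mulmxA mulmxV// mulmx1 [H y *m (G y *m _)]mulKmx//.
by rewrite addrC.
Qed.

Definition curvature_mx (n : nat) (C : 'I_m -> 'rV[R]_m -> 'M[R]_n) a b x :=
  curv (C^~ x) (fun a b => mpartial a (C b) x) a b.

Section Field.
Variables (r : nat) (A : 'I_m -> 'rV[R]_m -> 'M[R]_r).
Variables (F : 'rV[R]_m -> 'M[R]_(r, m)) (K : 'rV[R]_m -> 'M[R]_(m, r)).
Hypothesis (sA : forall k, msmooth U (A k)) (sF : msmooth U F) (sK : msmooth U K).

Let DF k y := mpartial k F y + F y *m gam G k y - A k y *m F y.

(** The two vanishing conditions are required on all of [U], so that differentiating them at [x]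
    supplies the remaining hypotheses of [divergence_identity]. *)
Lemma divergence_formula x : U x ->
  (forall y c, U y -> \sum_a DF a y c a = 0) ->
  (forall y a, U y -> \sum_b (K y *m DF b y) b a = 0) ->
  \sum_a \sum_b (K x *m (F x *m curvature_mx (gam G) a b x
                         - curvature_mx A a b x *m F x)) b a =
  - \sum_a \sum_b ((mpartial a K x + (gam G a x)^T *m K x + K x *m A a x)
                     *m DF b x) b a.
Proof.
move=> Ux divF V0.
have sFk k : msmooth U (mpartial k F) by apply: msmooth_partial.
have sFG k : msmooth U (fun y => F y *m gam G k y).
  by apply: msmoothM => //; exact: msmooth_gam.
have sAF k : msmooth U (fun y => A k y *m F y) by apply: msmoothM.
have sS k : msmooth U (fun y => mpartial k F y + F y *m gam G k y).
  exact: msmoothD.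
have sDF k : msmooth U (DF k).
  by apply: (msmoothD Uopen) => //; exact: msmoothN.
have dDF a b : mpartial a (DF b) x = mpartial a (mpartial b F) x
    + (mpartial a F x *m gam G b x + F x *m mpartial a (gam G b) x)
    - (mpartial a (A b) x *m F x + A b x *m mpartial a F x).
  rewrite /DF (mpartialD Uopen a (sS b) (msmoothN Uopen (sAF b)) Ux).
  rewrite (mpartialN Uopen a (sAF b) Ux) (mpartialD Uopen a (sFk b) (sFG b) Ux).
  rewrite (mpartialM Uopen a sF (msmooth_gam b) Ux).
  by rewrite (mpartialM Uopen a (sA b) sF Ux).
apply: (divergence_identity (Gam := (gam G)^~ x)
  (dGam := fun a b => mpartial a (gam G b) x) (A := A^~ x)
  (dA := fun a b => mpartial a (A b) x) (F := F x) (dF := fun a => mpartial a F x)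
  (ddF := fun a b => mpartial a (mpartial b F) x)
  (K := K x) (dK := fun a => mpartial a K x)).
- by move=> a b c; exact: gam_sym.
- by move=> a b; exact: mpartial_comm Ux.
- by move=> c; exact: divF.
- move=> b c; transitivity (partial b (fun y => \sum_a DF a y c a) x).
    rewrite (partial_sum Uopen _ _ _ Ux); last by move=> a; exact: sDF.
    by apply: eq_bigr => a _; rewrite -dDF mxE.
  rewrite -[RHS](partial_cst 0 b x); apply: (eq_partial Uopen) => // y Uy.
  exact: divF.
- by move=> a; exact: V0.
- move=> a; transitivity (partial a (fun y => \sum_b (K y *m DF b y) b a) x).
    rewrite (partial_sum Uopen _ _ _ Ux); last by move=> b; exact: msmoothM.
    apply: eq_bigr => b _; rewrite -dDF -(mpartialM Uopen a sK (sDF b) Ux).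
    by rewrite mxE.
  rewrite -[RHS](partial_cst 0 a x); apply: (eq_partial Uopen) => // y Uy.
  exact: V0.
Qed.

End Field.

End LeviCivita.

(** * Almost cokahler structures in a chart *)

Section AlmostCokahlerChart.
Variables (R : realType) (m : nat) (U : set 'rV[R]_m).
Hypothesis Uopen : open U.
Variables (G Om : 'rV[R]_m -> 'M[R]_m) (al : 'rV[R]_m -> 'rV[R]_m).
Hypothesis (sG : msmooth U G) (sOm : msmooth U Om) (sal : msmooth U al).
Let H y := invmx (G y).
Hypothesis G_sym : forall y, U y -> (G y)^T = G y.
Hypothesis G_frame : forall y, U y -> exists P : 'M[R]_m, P *m G y *m P^T = 1%:M.
Hypothesis Om_anti : forall y, U y -> (Om y)^T = - Om y.
Hypothesis OHO : forall y, U y ->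
  Om y *m H y *m Om y = (al y)^T *m al y - G y.
Hypothesis alO : forall y, U y -> al y *m H y *m Om y = 0.
Hypothesis al_unit : forall y, U y -> al y *m H y *m (al y)^T = 1%:M.
Hypothesis al_closed : forall y i j, U y ->
  partial i (fun x => al x 0 j) y - partial j (fun x => al x 0 i) y = 0.
Hypothesis Om_closed : forall y i j k, U y ->
  partial i (fun x => Om x j k) y + partial j (fun x => Om x k i) y
  + partial k (fun x => Om x i j) y = 0.

Let G_unit y : U y -> G y \in unitmx.
Proof. by move=> /G_frame[P PG]; exact: frame_unit PG. Qed.

Let H_sym y : U y -> (H y)^T = H y.
Proof. by move=> Uy; rewrite trmx_inv G_sym. Qed.

Let sH : msmooth U H.
Proof. exact: msmooth_inv. Qed.

(** Covariant derivatives along d_k of alpha and of omega; the 2 in [dcov2] counts the lower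
    indices, not the derivatives. *)
Definition dcov k y : 'rV[R]_m := mpartial k al y - al y *m (gam G k y)^T.
Definition dcov2 k y : 'M[R]_m :=
  mpartial k Om y - gam G k y *m Om y - Om y *m (gam G k y)^T.

Let mpartial_al k y : mpartial k al y = dcov k y + al y *m (gam G k y)^T.
Proof. by rewrite subrK. Qed.

Let mpartial_Om k y :
  mpartial k Om y = dcov2 k y + gam G k y *m Om y + Om y *m (gam G k y)^T.
Proof. by apply/matrixP => i j; rewrite !(mxaddE, mxoppE); ring. Qed.

Let dcovE k y j : dcov k y 0 j =
  partial k (fun x => al x 0 j) y - \sum_l gam G k y j l * al y 0 l.
Proof.
rewrite mxaddE mxoppE mpartialE; congr (_ - _); rewrite mxE.
by apply: eq_bigr => l _; rewrite [(_^T) _ _]mxE mulrC.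
Qed.

Let dcov2E a y b c : dcov2 a y b c = partial a (fun x => Om x b c) y
  - \sum_l gam G a y b l * Om y l c - \sum_l gam G a y c l * Om y b l.
Proof.
rewrite mxaddE mxaddE !mxoppE mpartialE; congr (_ - _ - _); rewrite mxE//.
by apply: eq_bigr => l _; rewrite [(_^T) _ _]mxE mulrC.
Qed.

Let dcov2_anti y i : U y -> (dcov2 i y)^T = - dcov2 i y.
Proof.
move=> Uy; rewrite /dcov2 !raddfB /= !trmx_mul trmxK Om_anti// -mpartial_tr.
rewrite (eq_mpartial (G := fun y => - Om y) Uopen _ Uy) ?(mpartialN Uopen i sOm)//.
rewrite !(mulNmx, mulmxN).
by apply/matrixP => j k; rewrite !(mxaddE, mxoppE); ring.
Qed.

Let dcov_sym y i j : U y -> dcov i y 0 j = dcov j y 0 i.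
Proof.
move=> Uy; apply: etrans (dcovE i y j) (etrans _ (esym (dcovE j y i))).
have -> : \sum_l gam G i y j l * al y 0 l = \sum_l gam G j y i l * al y 0 l.
  by apply: eq_bigr => l _; rewrite (gam_sym Uopen G_sym i j l Uy).
by congr (_ - _); apply/eqP; rewrite -subr_eq0 al_closed.
Qed.

(** In the cyclic sum the Christoffel terms cancel in pairs, by torsion-freeness and antisymmetry of
    omega; d omega is left. *)
Let dcov2_cyc y i j k : U y ->
  dcov2 i y j k + dcov2 j y k i + dcov2 k y i j = 0.
Proof.
move=> Uy; apply: (etrans (congr2 +%R (congr2 +%R (dcov2E i y j k)
  (dcov2E j y k i)) (dcov2E k y i j))).
have S a b c : \sum_l gam G a y b l * Om y l c = - \sum_l gam G b y a l * Om y c l.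
  rewrite -sumrN; apply: eq_bigr => l _.
  rewrite (gam_sym Uopen G_sym a b l Uy) -mulrN; congr (_ * _).
  by rewrite -mxoppE -Om_anti// mxE.
rewrite (S i j k) (S j k i) (S k i j); move: (Om_closed i j k Uy).
lra.
Qed.

(** Derivative of [OHO]. The Christoffel terms recombine into [OHO] multiplied by [Ga] or [Ga^T],
    which [OHO1] and [OHO2] eliminate. *)
Let mpartial_OHO y k : U y ->
  dcov2 k y *m H y *m Om y + Om y *m H y *m dcov2 k y =
  (dcov k y)^T *m al y + (al y)^T *m dcov k y.
Proof.
move=> Uy.
have sOH := msmoothM Uopen sOm sH.
have := eq_mpartial Uopen k Uy OHO.
rewrite (mpartialM Uopen k sOH sOm Uy) (mpartialM Uopen k sOm sH Uy).
have sala := msmoothM Uopen (msmooth_tr Uopen sal) sal.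
rewrite (mpartialD Uopen k sala (msmoothN Uopen sG) Uy) (mpartialN Uopen k sG Uy).
rewrite (mpartialM Uopen k (msmooth_tr Uopen sal) sal Uy) mpartial_tr.
rewrite (mpartial_invG Uopen sG G_sym G_unit _ Uy) -/(H y).
rewrite (mpartial_metric Uopen G_sym G_unit _ Uy) mpartial_Om mpartial_al.
move: (dcov2 k y) (dcov k y) (gam G k y) => D2 D Ga.
have OHO1 : Ga *m Om y *m H y *m Om y = Ga *m (al y)^T *m al y - Ga *m G y.
  by rewrite -!mulmxA [Om y *m (_ *m _)]mulmxA OHO// mulmxBr.
have OHO2 : Om y *m H y *m Om y *m Ga^T = (al y)^T *m al y *m Ga^T - G y *m Ga^T.
  by rewrite OHO// mulmxBl.
rewrite [(D + _)^T]raddfD /= trmx_mul trmxK.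
rewrite !(mulmxDl, mulmxDr, mulNmx, mulmxN, mulmxBl, mulmxBr) !mulmxA OHO1 OHO2.
move=> /matrixP E; apply/matrixP => i j; move: (E i j).
by rewrite !(mxaddE, mxoppE); lra.
Qed.

Let mpartial_alO y k : U y ->
  dcov k y *m H y *m Om y + al y *m H y *m dcov2 k y = 0.
Proof.
move=> Uy.
have saH := msmoothM Uopen sal sH.
have := eq_mpartial (G := fun=> 0) Uopen k Uy alO; rewrite mpartial_cst.
rewrite (mpartialM Uopen k saH sOm Uy) (mpartialM Uopen k sal sH Uy).
rewrite (mpartial_invG Uopen sG G_sym G_unit _ Uy) -/(H y).
rewrite mpartial_Om mpartial_al; move: (dcov2 k y) (dcov k y) (gam G k y) => D2 D Ga.
have alO2 : al y *m H y *m Om y *m Ga^T = 0 by rewrite alO// mul0mx.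
rewrite !(mulmxDl, mulmxDr, mulNmx, mulmxN, mulmxBl, mulmxBr) !mulmxA alO2.
move=> /matrixP E; apply/matrixP => i j; move: (E i j).
by rewrite !(mxaddE, mxoppE, mxzeroE); lra.
Qed.

Let mpartial_al_unit y k : U y -> dcov k y *m H y *m (al y)^T = 0.
Proof.
move=> Uy.
have saH := msmoothM Uopen sal sH.
have := eq_mpartial (G := fun=> 1%:M) Uopen k Uy al_unit; rewrite mpartial_cst.
rewrite (mpartialM Uopen k saH (msmooth_tr Uopen sal) Uy) mpartial_tr.
rewrite (mpartialM Uopen k sal sH Uy).
rewrite (mpartial_invG Uopen sG G_sym G_unit _ Uy) -/(H y) mpartial_al.
move: (dcov k y) (gam G k y) => D Ga.
have Dsym : al y *m H y *m D^T = (D *m H y *m (al y)^T)^T.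
  by rewrite !trmx_mul trmxK H_sym// mulmxA.
rewrite [(D + _)^T]raddfD /= trmx_mul trmxK.
rewrite !(mulmxDl, mulmxDr, mulNmx, mulmxN, mulmxBl, mulmxBr) !mulmxA Dsym.
move=> /matrixP/(_ 0 0) E; apply/matrixP => i j; rewrite !ord1; move: E.
rewrite !(mxaddE, mxoppE, mxzeroE) [(_^T) 0 0]mxE; lra.
Qed.

(** [P] is chosen point by point, with no regularity in [y]; the resulting identity in chart
    components still holds on all of [U], as [divergence_formula] requires. The same goes for
    [div_J] and [J_div]. *)
Let div_xi y : U y -> \sum_a (dcov a y *m H y) 0 a = 0.
Proof.
move=> Uy; have [P PG] := G_frame Uy.
exact: (div_al0 PG (Om_anti Uy) (alO Uy) (al_unit Uy)
  (fun i => dcov2_anti i Uy) (fun i => mpartial_OHO i Uy)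
  (fun i => mpartial_al_unit i Uy) (fun i j => dcov_sym i j Uy)
  (fun i j k => dcov2_cyc i j k Uy)).
Qed.

Let div_J y c : U y -> \sum_a (dcov2 a y *m H y) c a = 0.
Proof.
move=> Uy; have [P PG] := G_frame Uy.
exact: (div_om0 PG (Om_anti Uy) (OHO Uy) (alO Uy) (al_unit Uy)
  (fun i => dcov2_anti i Uy) (fun i => mpartial_OHO i Uy)
  (fun i => mpartial_alO i Uy)
  (fun i => mpartial_al_unit i Uy) (fun i j => dcov_sym i j Uy)
  (fun i j k => dcov2_cyc i j k Uy)).
Qed.

(** The vanishing of K^b nabla_b J for K = H Om H. *)
Let J_div y c : U y ->
  \sum_a (H y *m Om y *m H y *m (dcov2 a y *m H y)) a c = 0.
Proof.
move=> Uy; have [P PG] := G_frame Uy.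
have := (om_div0 PG (Om_anti Uy)
  (fun i => dcov2_anti i Uy) (fun i => mpartial_OHO i Uy)
  (fun i => mpartial_al_unit i Uy) (fun i j k => dcov2_cyc i j k Uy) c).
by move=> E; rewrite -[RHS]E; apply: eq_bigr => a _; rewrite !mulmxA.
Qed.

(* The Reeb field is geodesic since its covariant derivative is symmetric and
   it has constant length. *)
Let xi_geodesic y c : U y ->
  \sum_a ((al y *m H y)^T *m (dcov a y *m H y)) a c = 0.
Proof.
move=> Uy.
have E d : \sum_a (al y *m H y) 0 a * dcov a y 0 d = 0.
  transitivity ((dcov d y *m H y *m (al y)^T) 0 0).
    rewrite -mulmxA; have -> : H y *m (al y)^T = (al y *m H y)^T.
      by rewrite trmx_mul H_sym.
    rewrite mxE; apply: eq_bigr => a _.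
    by rewrite [(_^T) _ _]mxE mulrC; congr (_ * _); exact: dcov_sym.
  by rewrite mpartial_al_unit// mxzeroE.
transitivity (\sum_d (\sum_a (al y *m H y) 0 a * dcov a y 0 d) * H y d c).
  under [RHS]eq_bigr do rewrite mulr_suml.
  rewrite exchange_big/=; apply: eq_bigr => a _.
  rewrite mxE big_ord1 [(_^T) _ _]mxE [(dcov a y *m _) _ _]mxE mulr_sumr.
  by apply: eq_bigr => d _; rewrite mulrA.
by apply: big1 => d _; rewrite E mul0r.
Qed.

(** Raising an index commutes with covariant differentiation because the inverse metric is parallel;
    [cov_J] and [cov_K] rest on the same fact. *)
Let cov_xi k y : U y ->
  mpartial k (fun y => al y *m H y) y + al y *m H y *m gam G k y = dcov k y *m H y.
Proof.
move=> Uy; rewrite (mpartialM Uopen k sal sH Uy).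
rewrite (mpartial_invG Uopen sG G_sym G_unit _ Uy) -/(H y) mpartial_al.
move: (dcov k y) => D.
rewrite !(mulmxDl, mulmxDr, mulNmx, mulmxN) !mulmxA.
by apply/matrixP => i j; rewrite !(mxaddE, mxoppE); ring.
Qed.

Let cov_J k y : U y ->
  mpartial k (fun y => Om y *m H y) y + Om y *m H y *m gam G k y
  - gam G k y *m (Om y *m H y) = dcov2 k y *m H y.
Proof.
move=> Uy; rewrite (mpartialM Uopen k sOm sH Uy).
rewrite (mpartial_invG Uopen sG G_sym G_unit _ Uy) -/(H y) mpartial_Om.
move: (dcov2 k y) => D.
rewrite !(mulmxDl, mulmxDr, mulNmx, mulmxN) !mulmxA.
by apply/matrixP => i j; rewrite !(mxaddE, mxoppE); ring.
Qed.

Let cov_K k y : U y ->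
  mpartial k (fun y => H y *m Om y *m H y) y + (gam G k y)^T *m (H y *m Om y *m H y)
  + H y *m Om y *m H y *m gam G k y = H y *m dcov2 k y *m H y.
Proof.
move=> Uy; rewrite (mpartialM Uopen k (msmoothM Uopen sH sOm) sH Uy).
rewrite (mpartialM Uopen k sH sOm Uy).
rewrite (mpartial_invG Uopen sG G_sym G_unit _ Uy) -/(H y) mpartial_Om.
move: (dcov2 k y) => D.
rewrite !(mulmxDl, mulmxDr, mulNmx, mulmxN) !mulmxA.
by apply/matrixP => i j; rewrite !(mxaddE, mxoppE); ring.
Qed.

Lemma ricci_xi x : U x ->
  \sum_a \sum_b ((al x *m H x)^T *m
    (al x *m H x *m curvature_mx (gam G) a b x)) b a =
  - \sum_a \sum_b ((dcov a x *m H x)^T *m (dcov b x *m H x)) b a.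
Proof.
move=> Ux; have sxi := msmoothM Uopen sal sH.
(* A vector field takes values in the trivial line bundle with zero connection, whose curvature
   vanishes. *)
pose A (k : 'I_m) (y : 'rV[R]_m) : 'M[R]_1 := 0.
have sA k : msmooth U (A k) by exact: msmooth_cst.
have D k y : U y -> mpartial k (fun y => al y *m H y) y
    + al y *m H y *m gam G k y - A k y *m (al y *m H y) = dcov k y *m H y.
  by move=> Uy; rewrite mul0mx subr0 cov_xi.
have DK k : mpartial k (fun y => (al y *m H y)^T) x
    + (gam G k x)^T *m (al x *m H x)^T + (al x *m H x)^T *m A k x
    = (dcov k x *m H x)^T.
  rewrite mulmx0 addr0 mpartial_tr -trmx_mul; apply/esym.
  by rewrite -(cov_xi k Ux); exact: raddfD.
have cA a b : curvature_mx A a b x = 0.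
  by rewrite /curvature_mx /curv !mpartial_cst !mulmx0 !subr0 addr0.
have := divergence_formula Uopen sG G_sym G_unit sA sxi (msmooth_tr Uopen sxi) Ux.
under eq_bigr do under eq_bigr do rewrite cA mul0mx subr0.
move=> ->.
- congr (- _); apply: eq_bigr => a _; apply: eq_bigr => b _.
  by rewrite D// DK.
- by move=> y c Uy; rewrite ord1 -[RHS](div_xi Uy); apply: eq_bigr => a _; rewrite D.
- move=> y c Uy; rewrite -[RHS](xi_geodesic c Uy).
  by apply: eq_bigr => b _; rewrite D.
Qed.

Lemma curvature_J x : U x ->
  \sum_a \sum_b (H x *m Om x *m H x *m (Om x *m H x *m curvature_mx (gam G) a b x
     - curvature_mx (gam G) a b x *m (Om x *m H x))) b a =
  - \sum_a \sum_b (H x *m dcov2 a x *m H x *m dcov2 b x *m H x) b a.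
Proof.
move=> Ux; have sJ := msmoothM Uopen sOm sH.
have sK := msmoothM Uopen (msmoothM Uopen sH sOm) sH.
have sA := msmooth_gam Uopen sG G_unit.
rewrite (divergence_formula Uopen sG G_sym G_unit sA sJ sK Ux).
- congr (- _); apply: eq_bigr => a _; apply: eq_bigr => b _.
  by rewrite cov_J// cov_K// !mulmxA.
- by move=> y c Uy; rewrite -[RHS](div_J c Uy); apply: eq_bigr => a _; rewrite cov_J.
- move=> y c Uy; rewrite -[RHS](J_div c Uy).
  by apply: eq_bigr => b _; rewrite cov_J.
Qed.

(** The two contractions are -|nabla alpha|^2 and |nabla omega|^2 (norm of forms), compared in a
    frame at [x]. *)
Lemma curvature_estimate x : U x ->
  0 <= - (\sum_a \sum_b ((al x *m H x)^T *m
           (al x *m H x *m curvature_mx (gam G) a b x)) b a)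
    <= \sum_a \sum_b
    (H x *m Om x *m H x *m (Om x *m H x *m curvature_mx (gam G) a b x
      - curvature_mx (gam G) a b x *m (Om x *m H x))) b a.
Proof.
move=> Ux; have [P PG] := G_frame Ux.
rewrite curvature_J// ricci_xi// opprK.
have sym i j := dcov_sym i j Ux; have orth i := mpartial_al_unit i Ux.
have anti i := dcov2_anti i Ux; have cyc i j k := dcov2_cyc i j k Ux.
have dO i := mpartial_alO i Ux.
apply/andP; split; first exact: (second_fundamental_ge0 PG sym).
exact: (second_fundamental_le PG (Om_anti Ux) (OHO Ux) (al_unit Ux)
  anti dO orth sym cyc).
Qed.

End AlmostCokahlerChart.

(** * Curvature, Ricci and star-Ricci tensors *)

(** Relates the sum over [i < j] in [two_form_inner] to a full contraction, the source of the factor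
    2 in [star_tau_contract]. *)
Lemma sum_sym_lt (R : pzRingType) m (f : 'I_m -> 'I_m -> R) :
  (forall i j, f i j = f j i) -> (forall i, f i i = 0) ->
  \sum_i \sum_j f i j = 2 * \sum_(i < m) \sum_(j < m | (i < j)%N) f i j.
Proof.
move=> fs f0.
have E (i : 'I_m) : \sum_j f i j =
    \sum_(j < m | (i < j)%N) f i j + \sum_(j < m | (j < i)%N) f i j.
  rewrite (bigID (fun j : 'I_m => (i < j)%N))/=; congr (_ + _).
  rewrite (bigD1 i) ?ltnn//= f0 add0r; apply: eq_bigl => j.
  by rewrite -leqNgt ltn_neqAle andbC.
under eq_bigr do rewrite E.
rewrite big_split/= mulr_natl mulr2n; congr (_ + _).
rewrite (exchange_big_dep xpredT)//=; apply: eq_bigr => i _.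
by apply: eq_bigr => j _.
Qed.

Lemma sum_curv (R : comNzRingType) m p q (c : 'I_m -> 'I_m -> R)
    (D N : 'I_m -> 'I_m -> 'M[R]_(p, q)) :
  \sum_a \sum_b c a b *: D a b + \sum_a \sum_b c a b *: N b a
  - (\sum_a \sum_b c a b *: D b a + \sum_a \sum_b c a b *: N a b) =
  \sum_a \sum_b c a b *: (D a b - D b a + N b a - N a b).
Proof.
rewrite -!big_split -sumrN -big_split/=; apply: eq_bigr => a _.
rewrite -!big_split -sumrN -big_split/=; apply: eq_bigr => b _.
rewrite -!scalerDr -scalerN -scalerDr; congr (_ *: _).
by apply/matrixP => i j; rewrite !(mxaddE, mxoppE); ring.
Qed.

Lemma sum_delta (R : comNzRingType) m p q (X : 'I_m -> 'M[R]_(p, q)) k :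
  \sum_a (delta_mx 0 k : 'rV[R]_m) 0 a *: X a = X k.
Proof.
rewrite (bigD1 k)//= big1 ?addr0; first by rewrite mxE !eqxx scale1r.
by move=> a ak; rewrite mxE eqxx (negbTE ak) scale0r.
Qed.

Lemma sum3_cyc (R : comNzRingType) m p q (T : 'I_m -> 'I_m -> 'I_m -> 'M[R]_(p, q))
    (u v w : 'rV[R]_m) :
  (forall a b c, T a b c + T b c a + T c a b = 0) ->
  \sum_a \sum_b \sum_c (u 0 a * v 0 b * w 0 c) *: T a b c
  + \sum_a \sum_b \sum_c (v 0 a * w 0 b * u 0 c) *: T a b c
  + \sum_a \sum_b \sum_c (w 0 a * u 0 b * v 0 c) *: T a b c = 0.
Proof.
move=> Tcyc.
have -> : \sum_a \sum_b \sum_c (v 0 a * w 0 b * u 0 c) *: T a b c =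
    \sum_a \sum_b \sum_c (u 0 a * v 0 b * w 0 c) *: T b c a.
  under eq_bigr do rewrite exchange_big/=.
  rewrite exchange_big/=; apply: eq_bigr => a _; apply: eq_bigr => b _.
  by apply: eq_bigr => c _; congr (_ *: _); ring.
have -> : \sum_a \sum_b \sum_c (w 0 a * u 0 b * v 0 c) *: T a b c =
    \sum_a \sum_b \sum_c (u 0 a * v 0 b * w 0 c) *: T c a b.
  rewrite exchange_big/=; apply: eq_bigr => a _.
  rewrite exchange_big/=; apply: eq_bigr => b _.
  by apply: eq_bigr => c _; congr (_ *: _); ring.
rewrite -!big_split big1//= => a _; rewrite -!big_split big1//= => b _.
by rewrite -!big_split big1//= => c _; rewrite -!scalerDr Tcyc scaler0.
Qed.

Lemma exchange_sum22 (V : nmodType) m (f : 'I_m -> 'I_m -> 'I_m -> 'I_m -> V) :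
  \sum_i \sum_k \sum_a \sum_b f i k a b = \sum_a \sum_b \sum_i \sum_k f i k a b.
Proof.
under eq_bigr do rewrite exchange_big/=.
rewrite exchange_big/=; apply: eq_bigr => a _.
under eq_bigr do rewrite exchange_big/=.
by rewrite exchange_big.
Qed.

Section Curvature.
Variables (R : realType) (m : nat) (U : set 'rV[R]_m).
Hypothesis Uopen : open U.
Variable G : 'rV[R]_m -> 'M[R]_m.
Hypothesis sG : msmooth U G.
Hypothesis G_sym : forall y, U y -> (G y)^T = G y.
Hypothesis G_unit : forall y, U y -> G y \in unitmx.

Let Rm a b x := curvature_mx (gam G) a b x.

Definition dir_gam (v : 'rV[R]_m) y := \sum_b v 0 b *: gam G b y.

Lemma nabla_dir (u : 'rV[R]_m) Y x :
  nabla G (fun=> u) Y x =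
  (\row_k 'D_u (fun y => Y y 0 k) x) + Y x *m dir_gam u x.
Proof.
apply/rowP => k; rewrite !mxE; congr (_ + _).
rewrite exchange_big /=; apply: eq_bigr => j _.
rewrite summxE mulr_sumr; apply: eq_bigr => i _.
by rewrite !mxE [RHS]mulrA [Y x 0 j * u 0 i]mulrC.
Qed.

Lemma nabla_cst (u w : 'rV[R]_m) y :
  nabla G (fun=> u) (fun=> w) y = w *m dir_gam u y.
Proof.
rewrite nabla_dir; have -> : (\row_k 'D_u (fun=> w 0 k) y) = 0 :> 'rV[R]_m.
  by apply/rowP => k; rewrite !mxE derive_cst.
by rewrite add0r.
Qed.

Lemma lie_bracket_cst (u v : 'rV[R]_m) :
  lie_bracket (fun=> u) (fun=> v) = (fun=> 0 : 'rV[R]_m).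
Proof.
by apply/funext => x; apply/rowP => k; rewrite !mxE !derive_cst subrr.
Qed.

(** Derivatives along a general vector are expanded in partials here, through [derive_partials]. *)
Lemma derive_dir_gam (u v w : 'rV[R]_m) x : U x ->
  (\row_k 'D_u (fun y => (w *m dir_gam v y) 0 k) x) =
  w *m \sum_a \sum_b (u 0 a * v 0 b) *: mpartial a (gam G b) x.
Proof.
move=> Ux; have sgam := msmooth_gam Uopen sG G_unit.
have sv b j k : smooth_on U (fun y => v 0 b * gam G b y j k).
  by apply: smooth_mul => //; [exact: smooth_cst|exact: sgam].
have sdir j k : smooth_on U (fun y => dir_gam v y j k).
  have := @smooth_sum _ _ _ Uopen _ (index_enum 'I_m) xpredT _ (fun b _ => sv b j k).
  apply: eq_smooth_on => // y _; rewrite summxE; apply: eq_bigr => b _.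
  by rewrite [RHS]mxE.
have smul : msmooth U (fun y => w *m dir_gam v y).
  by apply: msmoothM => //; exact: msmooth_cst.
apply/rowP => k; rewrite mxE (derive_partials Uopen _ (smul 0 k) Ux).
rewrite mulmx_sumr summxE; apply: eq_bigr => a _.
rewrite -(mpartialE a (fun y => w *m dir_gam v y)).
rewrite (mpartialM Uopen a (msmooth_cst Uopen w) sdir Ux) mpartial_cst mul0mx add0r.
have -> : mpartial a (dir_gam v) x = \sum_b v 0 b *: mpartial a (gam G b) x.
  apply/matrixP => i j; rewrite mpartialE summxE.
  transitivity (partial a (fun y => \sum_b v 0 b * gam G b y i j) x).
    apply: (eq_partial Uopen) => // y _; rewrite summxE; apply: eq_bigr => b _.
    by rewrite [LHS]mxE.
  rewrite (partial_sum Uopen _ _ _ Ux)//; apply: eq_bigr => b _.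
  rewrite (partialM a (smooth_cst Uopen (v 0 b)) (sgam b i j) Ux) partial_cst.
  by rewrite mul0r add0r [RHS]mxE mpartialE.
rewrite -[u 0 a * _]/(u 0 a *: _).
under [in RHS]eq_bigr do rewrite -scalerA.
by rewrite -scaler_sumr -scalemxAr [RHS]mxE.
Qed.

Definition Rmx x (u v : 'rV[R]_m) : 'M[R]_m :=
  \sum_a \sum_b (u 0 a * v 0 b) *: Rm a b x.

(** Vectors extended by constant components have zero bracket, so only the two iterated derivatives
    remain; on row vectors their matrices compose in the reverse order, as in [curv]. *)
Lemma riemE x (u v w : 'rV[R]_m) : U x -> riem G x u v w = w *m Rmx x u v.
Proof.
move=> Ux; rewrite /riem /curvature lie_bracket_cst.
have -> : nabla G (fun=> 0) (fun=> w) x = 0.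
  rewrite nabla_cst /dir_gam big1 ?mulmx0// => b _.
  by rewrite mxE scale0r.
have nE z : nabla G (fun=> z) (fun=> w) = fun y => w *m dir_gam z y.
  by apply/funext => y; rewrite nabla_cst.
rewrite !nE !nabla_dir !derive_dir_gam// subr0 -!mulmxA -!mulmxDr -mulmxBr.
congr (_ *m _); rewrite /Rmx /Rm /curvature_mx /curv /dir_gam.
rewrite !mulmx_suml.
have E (s t : 'rV[R]_m) : \sum_i s 0 i *: gam G i x *m (\sum_b t 0 b *: gam G b x) =
    \sum_a \sum_b (s 0 a * t 0 b) *: (gam G a x *m gam G b x).
  apply: eq_bigr => i _; rewrite mulmx_sumr; apply: eq_bigr => j _.
  by rewrite -scalemxAl -scalemxAr scalerA.
rewrite !E.
have X (f : 'I_m -> 'I_m -> 'M[R]_m) : \sum_a \sum_b (v 0 a * u 0 b) *: f a b =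
    \sum_a \sum_b (u 0 a * v 0 b) *: f b a.
  rewrite exchange_big/=; apply: eq_bigr => a _; apply: eq_bigr => b _.
  by rewrite mulrC.
rewrite (X (fun a b => gam G a x *m gam G b x)).
rewrite (X (fun a b => mpartial a (gam G b) x)).
exact: (sum_curv (fun a b => u 0 a * v 0 b) (fun a b => mpartial a (gam G b) x)
  (fun a b => gam G a x *m gam G b x)).
Qed.

Lemma ricciE x (u v : 'rV[R]_m) : U x ->
  ricci G x u v = \sum_a \sum_b u 0 b * (v *m Rm a b x) 0 a.
Proof.
move=> Ux; apply: eq_bigr => k _; rewrite riemE//.
have -> : Rmx x (delta_mx 0 k) u = \sum_b u 0 b *: Rm k b x.
  rewrite -[RHS](sum_delta (fun a => \sum_b u 0 b *: Rm a b x)).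
  apply: eq_bigr => a _; rewrite scaler_sumr; apply: eq_bigr => b _.
  by rewrite scalerA.
rewrite mulmx_sumr summxE; apply: eq_bigr => b _.
by rewrite -scalemxAr mxE.
Qed.

Lemma Rm_antisym x a b : Rm b a x = - Rm a b x.
Proof. exact: curv_antisym. Qed.

Lemma row_gam_sym y a b : U y -> row b (gam G a y) = row a (gam G b y).
Proof.
by move=> Uy; apply/rowP => d; rewrite 2!row_entry; exact: (gam_sym Uopen G_sym).
Qed.

Lemma row_mpartial_gam_sym x a b c : U x ->
  row c (mpartial a (gam G b) x) = row b (mpartial a (gam G c) x).
Proof.
move=> Ux; apply/rowP => d; rewrite [LHS]mxE [RHS]mxE.
apply: etrans (mpartialE _ _ _ _ _) (etrans _ (esym (mpartialE _ _ _ _ _))).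
apply: (eq_partial Uopen) => // y Uy; exact: (gam_sym Uopen G_sym).
Qed.

Lemma bianchi x a b c : U x ->
  row c (Rm a b x) + row a (Rm b c x) + row b (Rm c a x) = 0.
Proof.
move=> Ux.
apply: curv_bianchi => [i j|i j k]; first exact: row_gam_sym.
exact: row_mpartial_gam_sym.
Qed.

Lemma Rm_metric x a b : U x -> (Rm a b x *m G x)^T = - (Rm a b x *m G x).
Proof.
move=> Ux; have sgam := msmooth_gam Uopen sG G_unit.
have E i j : mpartial i (mpartial j G) x =
    mpartial i (gam G j) x *m G x + gam G j x *m mpartial i G x
    + (mpartial i G x *m (gam G j x)^T + G x *m (mpartial i (gam G j) x)^T).
  have := eq_mpartial Uopen i Ux
    (fun y Uy => mpartial_metric Uopen G_sym G_unit j Uy).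
  move=> ->; have s1 := msmoothM Uopen (sgam j) sG.
  have s2 := msmoothM Uopen sG (msmooth_tr Uopen (sgam j)).
  rewrite (mpartialD Uopen i s1 s2 Ux) (mpartialM Uopen i (sgam j) sG Ux).
  by rewrite (mpartialM Uopen i sG (msmooth_tr Uopen (sgam j)) Ux) mpartial_tr.
apply: (curv_metric (G_sym Ux) (fun i => mpartial_metric Uopen G_sym G_unit i Ux) E).
exact: (mpartial_comm Uopen a b sG Ux).
Qed.

Lemma Rmx_bianchi x (u v w : 'rV[R]_m) : U x ->
  w *m Rmx x u v + u *m Rmx x v w + v *m Rmx x w u = 0.
Proof.
move=> Ux.
have E (s t z : 'rV[R]_m) : z *m Rmx x s t =
    \sum_a \sum_b \sum_c (s 0 a * t 0 b * z 0 c) *: row c (Rm a b x).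
  rewrite mulmx_sumr; apply: eq_bigr => a _; rewrite mulmx_sumr.
  apply: eq_bigr => b _; rewrite -scalemxAr {1}(row_sum_delta z) mulmx_suml.
  rewrite scaler_sumr; apply: eq_bigr => c _.
  by rewrite -scalemxAl -rowE scalerA.
rewrite (E u v w) (E v w u) (E w u v); apply: sum3_cyc => a b c.
exact: bianchi.
Qed.

Lemma Rmx_antisym x (u v : 'rV[R]_m) : Rmx x v u = - Rmx x u v.
Proof.
rewrite /Rmx exchange_big -sumrN; apply: eq_bigr => a _.
rewrite -sumrN; apply: eq_bigr => b _.
by rewrite Rm_antisym scalerN mulrC.
Qed.

Lemma Rmx_metric x (u v : 'rV[R]_m) : U x ->
  (Rmx x u v *m G x)^T = - (Rmx x u v *m G x).
Proof.
move=> Ux; rewrite /Rmx mulmx_suml raddf_sum -sumrN; apply: eq_bigr => a _.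
rewrite mulmx_suml /= raddf_sum -sumrN; apply: eq_bigr => b _ /=.
by rewrite -scalemxAl linearZ /= Rm_metric// scalerN.
Qed.

(** * The star-Ricci form in an orthonormal frame *)

Section StarTau.
Variables (x : 'rV[R]_m) (P Om : 'M[R]_m).
Hypothesis Ux : U x.
Hypothesis P_orth : P *m G x *m P^T = 1%:M.
Hypothesis Om_anti : Om^T = - Om.

Let W := P *m Om *m P^T.
(** The entry [r i k l j] is g(R(e_i, e_k) e_l, e_j). *)
Let r i k := P *m (Rmx x (row i P) (row k P) *m G x) *m P^T.

Let r_anti12 i k l j : r k i l j = - r i k l j.
Proof. by rewrite /r Rmx_antisym mulNmx mulmxN mulNmx mxoppE. Qed.

Let r_anti34 i k l j : r i k j l = - r i k l j.
Proof.
rewrite -[LHS]trmx_entry; rewrite -mxoppE; congr (fun_of_matrix _ _ _).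
by rewrite /r !trmx_mul trmxK -trmx_mul Rmx_metric// mulmxA mulmxN mulNmx.
Qed.

Let rowr i k l :
  row l (r i k) = row l P *m Rmx x (row i P) (row k P) *m (G x *m P^T).
Proof. by rewrite /r !row_mul !mulmxA. Qed.

Let r_bianchi i k l j : r i k l j + r k l i j + r l i k j = 0.
Proof.
have : row l (r i k) + row i (r k l) + row k (r l i) = 0.
  by rewrite !rowr -!mulmxDl Rmx_bianchi// mul0mx.
by move=> /rowP/(_ j); rewrite !(mxaddE, mxzeroE) 3!row_entry.
Qed.

Variable e : 'I_m -> 'rV[R]_m.
Hypothesis e_P : forall i, e i = row i P.
Variable OmF : 'rV[R]_m -> 'M[R]_m.
Hypothesis OmF_x : OmF x = Om.

Let GPP : G x *m P^T *m P = 1%:M.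
Proof. exact: frame_mulKV. Qed.

Let PP : P^T *m P = invmx (G x).
Proof. exact: frame_mulV. Qed.

Let J_eq : Om *m invmx (G x) = G x *m P^T *m W *m P.
Proof. by rewrite /W -PP !mulmxA GPP mul1mx. Qed.

Let PJ : P *m (Om *m invmx (G x)) = W *m P.
Proof. by rewrite J_eq !mulmxA P_orth mul1mx. Qed.

Let rho i j := star_ricci G OmF x e (e i) (e j).

Let rhoE i j : rho i j = \sum_k \sum_l W k l * r i k l j.
Proof.
apply: eq_bigr => k _; rewrite riemE// /bil /Jend OmF_x !e_P.
transitivity ((W *m r i k) k j); last by rewrite mxE.
have -> : row k P *m (Om *m invmx (G x)) *m Rmx x (row i P) (row k P) *m G x
    *m (row j P)^T = row k P *m (Om *m invmx (G x) *m (Rmx x (row i P) (row k P)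
    *m G x)) *m (row j P)^T by rewrite !mulmxA.
rewrite row_form; congr (fun_of_matrix _ _ _).
by rewrite [P *m (_ *m _)]mulmxA PJ /r !mulmxA.
Qed.

Let W_swap i j : W j i = - W i j.
Proof.
rewrite -mxoppE; have -> : - W = W^T; last by rewrite trmx_entry.
by rewrite /W !trmx_mul trmxK Om_anti mulNmx mulmxN mulmxA.
Qed.

(** [two_form_inner] reads only the entries with [i < j], so antisymmetry is needed to pass to a
    full contraction. The Bianchi identity gives rho_ab = -1/2 sum_kl W_kl R_klab, antisymmetric in
    a and b by metric compatibility. *)
Let rho_anti i j : rho j i = - rho i j.
Proof.
have E a b : rho a b = - 2^-1 * \sum_k \sum_l W k l * r k l a b.
  rewrite rhoE.
  have S : \sum_k \sum_l W k l * r l a k b = \sum_k \sum_l W k l * r a k l b.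
    rewrite exchange_big/=; apply: eq_bigr => k _; apply: eq_bigr => l _.
    by rewrite W_swap r_anti12; ring.
  have : \sum_k \sum_l W k l * (r a k l b + r k l a b + r l a k b) = 0.
    by apply: big1 => k _; apply: big1 => l _; rewrite r_bianchi mulr0.
  under eq_bigr do under eq_bigr do rewrite !mulrDr.
  under eq_bigr do rewrite !big_split/=.
  by rewrite !big_split/= S; lra.
rewrite !E -mulrN -sumrN; congr (_ * _); apply: eq_bigr => k _.
by rewrite -sumrN; apply: eq_bigr => l _; rewrite r_anti34 mulrN.
Qed.

(** The right side is the half of the left side of [curvature_J] in which the curvature stands
    between K and J. *)
Lemma star_tau_contract :
  2 * two_form_inner e (bil Om) (star_ricci G OmF x e) =
  - \sum_a \sum_b (invmx (G x) *m Om *m invmx (G x) *m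
       (Rm a b x *m (Om *m invmx (G x)))) b a.
Proof.
have WE i j : bil Om (e i) (e j) = W i j by rewrite /bil !e_P row_form.
transitivity (\sum_i \sum_j W i j * rho i j).
  rewrite (sum_sym_lt (f := fun i j => W i j * rho i j)).
  - congr (_ * _); apply: eq_bigr => i _; apply: eq_bigr => j _.
    by rewrite WE.
  - by move=> i j; rewrite W_swap rho_anti mulrNN.
  - move=> i; have E := rho_anti i i.
    by have -> : rho i i = 0; [lra|rewrite mulr0].
have E a b : (invmx (G x) *m Om *m invmx (G x) *m
       (Rm a b x *m (Om *m invmx (G x)))) b a =
    \sum_i \sum_k (P i a * P k b) * (W *m (P *m (Rm a b x *m G x) *m P^T) *m W) k i.
  have -> : invmx (G x) *m Om *m invmx (G x) *m (Rm a b x *m (Om *m invmx (G x))) =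
      P^T *m (W *m (P *m (Rm a b x *m G x) *m P^T) *m W) *m P.
    by rewrite J_eq -PP /W !mulmxA.
  rewrite mxE; apply: eq_bigr => i _; rewrite mxE mulr_suml.
  by apply: eq_bigr => k _; rewrite [(_^T) _ _]mxE; ring.
have Er i k : r i k = \sum_a \sum_b (P i a * P k b) *:
    (P *m (Rm a b x *m G x) *m P^T).
  rewrite /r mulmx_suml mulmx_sumr mulmx_suml; apply: eq_bigr => a _.
  rewrite mulmx_suml mulmx_sumr mulmx_suml; apply: eq_bigr => b _.
  by rewrite -scalemxAl -scalemxAr -scalemxAl !row_entry.
transitivity (- \sum_i \sum_k (W *m r i k *m W) k i).
  rewrite -sumrN; apply: eq_bigr => i _.
  under eq_bigr do rewrite rhoE mulr_sumr.
  rewrite exchange_big -sumrN/=; apply: eq_bigr => k _.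
  rewrite [in RHS]mxE -sumrN; apply: eq_bigr => j _.
  rewrite (W_swap i j) mulrN opprK mulrC; congr (_ * _).
  by rewrite [RHS]mxE.
have {}Er i k : (W *m r i k *m W) k i = \sum_a \sum_b (P i a * P k b)
    * (W *m (P *m (Rm a b x *m G x) *m P^T) *m W) k i.
  rewrite Er mulmx_sumr mulmx_suml summxE; apply: eq_bigr => a _.
  rewrite mulmx_sumr mulmx_suml summxE; apply: eq_bigr => b _.
  by rewrite -scalemxAr -scalemxAl [LHS]mxE.
congr (- _); pose f i k a b :=
  (P i a * P k b) * (W *m (P *m (Rm a b x *m G x) *m P^T) *m W) k i.
transitivity (\sum_i \sum_k \sum_a \sum_b f i k a b).
  by apply: eq_bigr => i _; apply: eq_bigr => k _; exact: Er.
rewrite exchange_sum22; apply: eq_bigr => a _; apply: eq_bigr => b _.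
exact: esym (E a b).
Qed.

End StarTau.

End Curvature.

(** * Adapted coframes *)

Lemma sum_pairs (V : nmodType) n (f : nat -> V) :
  \sum_(i < n.*2) f i = \sum_(k < n) (f k.*2 + f k.*2.+1).
Proof.
elim: n => [|n IH]; first by rewrite !big_ord0.
by rewrite doubleS !big_ord_recr /= IH addrA.
Qed.

Section Coframe.
Variables (K : realType) (n : nat).
Variables (G : 'M[K]_n.*2.+1) (th : 'I_n.*2.+1 -> 'rV[K]_n.*2.+1).
Hypothesis (G_sym : G^T = G) (G_unit : G \in unitmx).
Hypothesis th_orth : orthonormal_coframe G th.
Let H := invmx G.
Let al := th ord_max.
Let ev k := th (inord k.*2).
Let od k := th (inord k.*2.+1).
Let Om := \sum_(k < n) wedge (ev k) (od k).

Let Th := \matrix_i th i.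

Let H_sym : H^T = H.
Proof. by rewrite trmx_inv G_sym. Qed.

Let thH i j : th i *m H *m (th j)^T = (i == j)%:R%:M.
Proof. by rewrite [LHS]mx11_scalar; congr (_%:M); exact: th_orth. Qed.

Let ThH : Th *m H *m Th^T = 1%:M.
Proof.
apply/matrixP => i j; transitivity ((th i *m H *m (th j)^T) 0 0).
  rewrite [LHS]mxE [RHS]mxE; apply: eq_bigr => k _.
  rewrite !trmx_entry mxE; congr (_ * _); last by rewrite mxE.
  by rewrite [RHS]mxE; apply: eq_bigr => l _; rewrite mxE.
by rewrite thH !mxE eqxx mulr1n.
Qed.

(** The witness is the dual frame, the coframe with its index raised. *)
Lemma coframe_frame : exists P : 'M[K]_n.*2.+1, P *m G *m P^T = 1%:M.
Proof.
exists (Th *m H); rewrite trmx_mul H_sym -!mulmxA [G *m _]mulmxA mulmxV//.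
by rewrite mul1mx mulmxA.
Qed.

Let G_sum : G = \sum_i (th i)^T *m th i.
Proof.
have -> : G = Th^T *m Th by rewrite (frame_mulV ThH) invmxK.
apply/matrixP => i j; rewrite mxE summxE; apply: eq_bigr => k _.
by rewrite !mxE big_ord1 !mxE.
Qed.

Let G_split : G = \sum_(k < n) ((ev k)^T *m ev k + (od k)^T *m od k)
  + al^T *m al.
Proof.
rewrite G_sum big_ord_recr /=; congr (_ + _).
pose f i := (th (inord i))^T *m th (inord i).
rewrite -(sum_pairs n f); apply: eq_bigr => i _.
rewrite /f; have -> // : inord i = widen_ord (leqnSn _) i :> 'I_n.*2.+1.
by apply: val_inj; rewrite /= inordK// ltnS ltnW.
Qed.

Let ev_lt (k : 'I_n) : (k.*2 < n.*2.+1)%N.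
Proof. by rewrite ltnS leq_double ltnW. Qed.

Let od_lt (k : 'I_n) : (k.*2.+1 < n.*2.+1)%N.
Proof. by rewrite ltnS ltn_double. Qed.

Let pair_prods (k l : 'I_n) :
  [/\ ev k *m H *m (ev l)^T = (k == l)%:R%:M,
      od k *m H *m (od l)^T = (k == l)%:R%:M,
      ev k *m H *m (od l)^T = 0 & od k *m H *m (ev l)^T = 0].
Proof.
rewrite !thH -!val_eqE /= !inordK// eqSS (inj_eq double_inj).
have -> : (k.*2 == l.*2.+1)%N = false.
  by apply/negbTE/eqP => /(congr1 odd); rewrite /= !odd_double.
have -> : (k.*2.+1 == l.*2)%N = false.
  by apply/negbTE/eqP => /(congr1 odd); rewrite /= !odd_double.
by split=> //; exact: raddf0.
Qed.

Let al_prods (k : 'I_n) :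
  al *m H *m (ev k)^T = 0 /\ al *m H *m (od k)^T = 0.
Proof.
have kn := ltn_ord k.
rewrite !thH -!val_eqE /= !inordK//.
by rewrite !gtn_eqF ?ltn_double// ?raddf0// -doubleS leq_double.
Qed.

Lemma coframe_unit : al *m H *m al^T = 1%:M.
Proof. by rewrite thH eqxx. Qed.

Lemma coframe_xi : al *m H *m Om = 0.
Proof.
rewrite mulmx_sumr big1// => k _; have [a1 a2] := al_prods k.
by rewrite mulmxBr !mulmxA a1 a2 !mul0mx subr0.
Qed.

Let rank1_prod (x y z t : 'rV[K]_n.*2.+1) (c : K) : y *m H *m z^T = c%:M ->
  x^T *m y *m H *m (z^T *m t) = c *: (x^T *m t).
Proof.
move=> E; rewrite -[x^T *m y *m H]mulmxA -mulmxA [y *m H *m _]mulmxA E mul_scalar_mx.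
by rewrite scalemxAr.
Qed.

(** Distinct pairs are orthogonal; within one pair the product is minus the metric of the plane they
    span. *)
Let wedge_prod (k l : 'I_n) :
  wedge (ev k) (od k) *m H *m wedge (ev l) (od l) =
  - ((k == l)%:R *: ((ev k)^T *m ev l + (od k)^T *m od l)).
Proof.
have [a1 a2 a3 a4] := pair_prods k l.
rewrite -(raddf0 (@scalar_mx K 1)) in a3 a4.
rewrite /wedge !(mulmxBl, mulmxBr) (rank1_prod _ _ a1) (rank1_prod _ _ a2).
rewrite (rank1_prod _ _ a3) (rank1_prod _ _ a4) !scale0r.
by rewrite scalerDr subr0 sub0r opprD addrC.
Qed.

(** J squared is minus the identity on ker alpha: the n planes and the line of alpha add up to the
    metric, by [G_split]. *)
Lemma coframe_square : Om *m H *m Om = al^T *m al - G.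
Proof.
rewrite [in RHS]G_split opprD addrCA subrr addr0 -sumrN mulmx_suml mulmx_suml.
apply: eq_bigr => k _; rewrite mulmx_sumr (bigD1 k)//= big1 ?addr0.
  by rewrite wedge_prod eqxx scale1r.
by move=> l lk; rewrite wedge_prod eq_sym (negbTE lk) scale0r oppr0.
Qed.

Lemma coframe_anti : Om^T = - Om.
Proof.
rewrite raddf_sum -sumrN; apply: eq_bigr => k _ /=.
by rewrite raddfB /= !trmx_mul !trmxK opprB.
Qed.

End Coframe.

(** * The Einstein condition and the two inequalities *)

Theorem proposition3p3 (R : realType) (n : nat) (hn : (0 < n)%N)
    (M : manifold R n.*2.+1) (alpha : covector_field M)
    (omega g : bilinear_field M) (tau : R)
    (hM : almost_cokahler alpha omega g) (hE : einstein g tau)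
    (p : M) (a : chart_index M) (hp : chart_dom a p)
    (e : 'I_n.*2.+1 -> 'rV[R]_n.*2.+1)
    (he : orthonormal_basis (g a (chart a p)) e) :
  0 <= - tau <=
    (2 * n)%:R * (star_tau n (g a) (omega a) (chart a p) e - tau).
Proof.
case: hM => -[[sal _] [[som _] _] [[sg _] g_pos] coframe] al_closed om_closed.
pose U := chart a @` chart_dom a; set x := chart a p in he *.
have Uopen : open U by exact: chart_img_open.
have Ux : U x by exists p.
have UE : chart a @` (chart_dom a `&` setT) = U by rewrite setIT.
have s_al : msmooth U (alpha a) by move=> i j; rewrite ord1 -UE; exact: sal.
have s_om : msmooth U (omega a) by move=> i j; rewrite -UE; exact: som.
have s_g : msmooth U (g a) by move=> i j; rewrite -UE; exact: sg.
have g_sym y : U y -> (g a y)^T = g a y.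
  by move=> [q qa <-]; have [] := g_pos a q qa.
have g_unit y : U y -> g a y \in unitmx.
  move=> [q qa <-]; have [_ pos] := g_pos a q qa.
  rewrite -row_free_unit -kermx_eq0.
  apply/negPn/negP => /rowV0Pn[u /sub_kermxP uG u0].
  by have := pos u u0; rewrite uG mul0mx mxE ltxx.
have frame y : U y -> exists th : 'I_n.*2.+1 -> 'rV[R]_n.*2.+1,
    [/\ orthonormal_coframe (g a y) th, alpha a y = th ord_max &
     omega a y = \sum_(k < n) wedge (th (inord k.*2)) (th (inord k.*2.+1))].
  move=> [q qa <-]; have [W [th [_ Wq _ thP]]] := coframe q.
  by exists (fun i => th i a (chart a q)); have [? ? ?] := thP a q Wq qa.
have om_anti y : U y -> (omega a y)^T = - omega a y.
  by move=> /frame[th [_ _ ->]]; exact: coframe_anti.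
have om_sq y : U y -> omega a y *m invmx (g a y) *m omega a y =
    (alpha a y)^T *m alpha a y - g a y.
  move=> Uy; have [th [tho -> ->]] := frame y Uy.
  exact: coframe_square tho.
have al_om y : U y -> alpha a y *m invmx (g a y) *m omega a y = 0.
  by move=> Uy; have [th [tho -> ->]] := frame y Uy; exact: coframe_xi.
have al_unit y : U y -> alpha a y *m invmx (g a y) *m (alpha a y)^T = 1%:M.
  by move=> Uy; have [th [tho -> _]] := frame y Uy; exact: coframe_unit.
have g_frame y : U y -> exists P : 'M[R]_n.*2.+1, P *m g a y *m P^T = 1%:M.
  move=> Uy; have [th [tho _ _]] := frame y Uy.
  exact: (coframe_frame (g_sym y Uy) (g_unit y Uy) tho).
have al_cl y i j : U y -> partial i (fun x => alpha a x 0 j) y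
    - partial j (fun x => alpha a x 0 i) y = 0.
  by move=> [q qa <-]; exact: al_closed.
have om_cl y i j k : U y -> partial i (fun x => omega a x j k) y
    + partial j (fun x => omega a x k i) y
    + partial k (fun x => omega a x i j) y = 0.
  by move=> [q qa <-]; exact: om_closed.
have ric u v := ricciE Uopen s_g g_unit u v Ux; cbv beta in ric.
(* The basis [e] need not be adapted to omega; it serves the star-Ricci form and the scalar
   curvature, while [curvature_estimate] takes its own frame from [g_frame]. *)
pose P := \matrix_i e i.
have eP i : e i = row i P by rewrite rowK.
have P_orth : P *m g a x *m P^T = 1%:M.
  apply/matrixP => i j; transitivity (bil (g a x) (e i) (e j)).
    by rewrite /bil !eP row_form.
  by rewrite he mxE.
have star := star_tau_contract Uopen s_g g_sym g_unit Ux P_orth (om_anti x Ux) eP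
  (erefl (omega a x)).
have est := curvature_estimate Uopen s_g s_om s_al g_sym g_frame om_anti om_sq al_om
  al_unit al_cl om_cl Ux.
cbv beta in star, est; rewrite /star_tau.
have PP := frame_mulV P_orth.
have H_sym : (invmx (g a x))^T = invmx (g a x) by rewrite trmx_inv g_sym.
have oo := om_sq x Ux; have au := al_unit x Ux; have gu := g_unit x Ux.
have einst u v : ricci (g a) x u v = tau * bil (g a x) u v by exact: hE.
move: (two_form_inner _ _ _) star est => T2 star.
pose Rm i j := curvature_mx (gam (g a)) i j x.
set H := invmx (g a x) in PP H_sym oo au star *.
set xi := alpha a x *m H; set Ric := \sum_i _; set S2 := \sum_i _.
have RicE : Ric = tau.
  have xi_unit : bil (g a x) xi xi = 1.
    by rewrite /bil /xi mulmxKV// trmx_mul H_sym mulmxA au mxE.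
  transitivity (ricci (g a) x xi xi); last by rewrite einst xi_unit mulr1.
  rewrite ric; apply: eq_bigr => i _; apply: eq_bigr => j _.
  by rewrite [LHS]mxE big_ord1 trmx_entry.
(* The scalar curvature: Ricci summed over the 2n+1 vectors of [e], with [PP] turning the sum into a
   contraction with [H]. *)
have scal : \sum_i \sum_j (H *m Rm i j) j i = tau * n.*2.+1%:R.
  transitivity (\sum_k ricci (g a) x (e k) (e k)); last first.
    under eq_bigr do rewrite einst he eqxx mulr1.
    by rewrite sumr_const card_ord mulr_natr.
  under [RHS]eq_bigr do rewrite ric.
  rewrite [RHS]exchange_big; apply: eq_bigr => i _.
  rewrite [RHS]exchange_big; apply: eq_bigr => j _.
  rewrite -PP -mulmxA mxE; apply: eq_bigr => k _.
  by rewrite trmx_entry eP row_entry -row_mul row_entry.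
(* This identity splits the contraction of K J with the curvature into Ric(xi, xi) minus the scalar
   curvature. *)
have KJ : H *m omega a x *m H *m (omega a x *m H) = xi^T *m xi - H.
  have -> : H *m omega a x *m H *m (omega a x *m H) =
      H *m (omega a x *m H *m omega a x) *m H.
    by rewrite !mulmxA.
  rewrite oo mulmxBr mulmxBl mulVmx// mul1mx; congr (_ - _).
  by rewrite /xi trmx_mul H_sym !mulmxA.
rewrite RicE => est; have {}est : 0 <= - tau <= tau - tau * n.*2.+1%:R + 2 * T2.
  suff -> : tau - tau * n.*2.+1%:R + 2 * T2 = S2 by [].
  rewrite star -scal -{1}RicE /Ric /S2 -!sumrN -!big_split; apply: eq_bigr => i _ /=.
  rewrite -!sumrN -!big_split; apply: eq_bigr => j _ /=.
  rewrite [in RHS]mulmxBr [in RHS]mxaddE mxoppE; congr (_ - _).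
  by rewrite [in RHS]mulmxA KJ mulmxBl -[in RHS]mulmxA mxaddE mxoppE.
(* Since [star_tau] is [T2] divided by n, cancelling n leaves [2 * T2], and tau - (2n+1) tau is -2n
   tau. *)
have n0 : n%:R != 0 :> R by rewrite pnatr_eq0 -lt0n.
suff -> : (2 * n)%:R * (n%:R^-1 * T2 - tau) =
  tau - tau * n.*2.+1%:R + 2 * T2 by [].
by rewrite -addn1 natrD -mul2n natrM mulrBr mulrA mulfK//; ring.
Qed.
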